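(* Let $\delta_1,\delta_2$ be real constants and $\tau=\log\frac{1-\sin\delta_1}{1+\sin\delta_1}$. Kuen's surface and its associated family with parameter $\lambda=e^t$, $t\in\mathbb{R}$, as a double transformation of the straight line, are given by $$f_{Kuen}(k,\ell,t)=f_0(k,\ell,t)+\frac{2\cosh(k\tau)\operatorname{sech}t}{\cosh^2(k\tau)+4\ell^2\tan^2\delta_2}\begin{bmatrix}2\ell\tan\delta_2\tanh t\,\operatorname{sech}(k\tau)-\sinh(k\tau)\\ 2\ell\tan\delta_2\operatorname{Im}\omega\,\operatorname{sech}t-\operatorname{Re}\omega\,(2\ell\tan\delta_2\tanh t\tanh(k\tau)+1)\\ \operatorname{Im}\omega\,(2\ell\tan\delta_2\tanh t\tanh(k\tau)+1)+2\ell\tan\delta_2\operatorname{Re}\omega\,\operatorname{sech}t\end{bmatrix}$$ with Gauss map $$n_{Kuen}(k,\ell,t)=\frac{\operatorname{sech}^2t}{\cosh^2(k\tau)+4\ell^2\tan^2\delta_2}\begin{bmatrix}2\,(2\ell\tan\delta_2\cosh t\sinh(k\tau)+\sinh t\cosh(k\tau))\\ \operatorname{Im}\omega\,D+\operatorname{Re}\omega\,E\\ \operatorname{Re}\omega\,D-\operatorname{Im}\omega\,E\end{bmatrix},$$ where $$D=(1-\sinh^2t)\cosh^2(k\tau)-4\ell^2\tan^2\delta_2\cosh^2t,\qquad E=4\ell\tan\delta_2\cosh t-\sinh t\sinh(2k\tau),$$ $f_0(k,\ell,t)=(-2x(k,\ell,t),0,0)$, and $$x(k,\ell,t)=k\,\frac{\cosh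 t\sin\delta_1}{1+\sinh^2t\sin^2\delta_1}+\ell\,\frac{\sinh t\sin\delta_2\cos\delta_2}{1+\sinh^2t\sin^2\delta_2},\qquad \omega(k,\ell,t)=\left(\frac{i+\sinh t\sin\delta_1}{i-\sinh t\sin\delta_1}\right)^k\left(\frac{i+\cosh t\tan\delta_2}{i-\cosh t\tan\delta_2}\right)^\ell.$$
   Context: Quaternions: $\mathbb{H}$ is the real span of the $2\times2$ matrices $\mathbb{1},-i\sigma_1,-i\sigma_2,-i\sigma_3$, with Pauli matrices $\sigma_1=\begin{pmatrix}0&1\\1&0\end{pmatrix}$, $\sigma_2=\begin{pmatrix}0&-i\\i&0\end{pmatrix}$, $\sigma_3=\begin{pmatrix}1&0\\0&-1\end{pmatrix}$. $\mathbb{R}^3$ is identified with trace-free quaternions by $(x_1,x_2,x_3)\leftrightarrow\sum_jx_j(-i\sigma_j)$; $[X]^{\mathrm{tr}=0}$ is the trace-free part. For a map $g$ on $\mathbb{Z}^2$: $g=g(k,\ell)$, $g_1=g(k+1,\ell)$, $g_2=g(k,\ell+1)$ ($\delta_1,\delta_2$ are not shifts). Lax matrices: for a unitary vertex function $s$ and edge functions $l,m$ and spectral parameter $\lambda=e^t$, $$L=\begin{pmatrix}\cot\frac{\delta_1}2\frac{l}{s}+\tan\frac{\delta_1}2\,l s_1& i(\lambda-\frac{ss_1}{\lambda})\\ i(\lambda-\frac{1}{\lambda ss_1})&\cot\frac{\delta_1}2\frac{s}{l}+\tan\frac{\delta_1}2\frac{1}{l s_1}\end{pmatrix},\quad M=\begin{pmatrix}\cot\frac{\delta_2}2\frac{m}{s}+\tan\frac{\delta_2}2\,m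 s_2& i(\lambda-\frac{ss_2}{\lambda})\\ i(\lambda-\frac{1}{\lambda ss_2})&\cot\frac{\delta_2}2\frac{s}{m}+\tan\frac{\delta_2}2\frac{1}{m s_2}\end{pmatrix}.$$ The net with frame $\Phi$ ($\Phi_1=L\Phi$, $\Phi_2=M\Phi$) is $f=2[\Phi^{-1}\partial_t\Phi]^{\mathrm{tr}=0}$, $n=-i\Phi^{-1}\sigma_3\Phi$; varying $t$ gives its associated family. Straight line: the case $s_0(k,\ell)=l_0(k,\ell)=m_0(k,\ell)=(-1)^\ell$, with frame $\Phi_0$, $\Phi_0(0,0)=\mathbb{1}$; its net is $f_0=(-2x,0,0)$, $n_0=(0,\operatorname{Im}\omega,\operatorname{Re}\omega)$. Kuen's surface (with its associated family): the double Bäcklund transform of the straight line with parameters $\pm\alpha$, $\tan\frac\alpha2=1$. Its frame is $B\Phi_0$ with $$B=\begin{pmatrix}s_b\bigl(s_{db}+\frac1{s_0}\bigr)& i\bigl(\lambda-\frac{s_{db}s_0}{\lambda}\bigr)\\ i\bigl(\lambda-\frac1{\lambda s_{db}s_0}\bigr)&\frac1{s_b}\bigl(\frac{1}{s_{db}}+s_0\bigr)\end{pmatrix},$$ where the unitary functions $s_b,s_{db}$ on $\mathbb{Z}^2$, with $s_b(0,0)=i$, $s_{db}(0,0)=1$, are determined by the requirement that $B_1L=\tilde LB$, $B_2M=\tilde MB$ for all $\lambda$, with $L,M$ the Lax matrices of the straight line and $\tilde L,\tilde M$ the Lax matrices (same $\delta_1,\delta_2$) with vertex function $s_{db}$ and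 suitable edge functions $\tilde l,\tilde m$, i.e., writing $s_{db,1}=s_{db}(k+1,\ell)$ and $s_{db,2}=s_{db}(k,\ell+1)$, $$\tilde L=\begin{pmatrix}\cot\frac{\delta_1}2\frac{\tilde l}{s_{db}}+\tan\frac{\delta_1}2\,\tilde l s_{db,1}& i(\lambda-\frac{s_{db}s_{db,1}}{\lambda})\\ i(\lambda-\frac{1}{\lambda s_{db}s_{db,1}})&\cot\frac{\delta_1}2\frac{s_{db}}{\tilde l}+\tan\frac{\delta_1}2\frac{1}{\tilde l s_{db,1}}\end{pmatrix},\quad \tilde M=\begin{pmatrix}\cot\frac{\delta_2}2\frac{\tilde m}{s_{db}}+\tan\frac{\delta_2}2\,\tilde m s_{db,2}& i(\lambda-\frac{s_{db}s_{db,2}}{\lambda})\\ i(\lambda-\frac{1}{\lambda s_{db}s_{db,2}})&\cot\frac{\delta_2}2\frac{s_{db}}{\tilde m}+\tan\frac{\delta_2}2\frac{1}{\tilde m s_{db,2}}\end{pmatrix}.$$ Explicitly (as the limit $\mu\to0$ of the analogous solution for $\tan\frac\alpha2=e^{i\mu}$), $$s_b(k,\ell)=(-1)^\ell\Bigl(-1+\frac{2}{1-ie^{-k\tau}}\Bigr),\qquad s_{db}(k,\ell)=(-1)^\ell\Bigl(-1+\frac{2}{1-2i\ell\tan\delta_2\operatorname{sech}(k\tau)}\Bigr).$$ Parameters $\delta_1,\delta_2$ are such that all expressions are defined (e.g. $\sin\delta_1\neq0,\pm1$, $\sin\delta_2\cos\delta_2\ne0$). *)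

(* Defs.v *)
From HB Require Import structures.
From mathcomp Require Import all_boot all_order all_algebra.
From mathcomp Require Import all_classical all_reals all_analysis.
From mathcomp Require Export complex.

Set Implicit Arguments.
Unset Strict Implicit.
Unset Printing Implicit Defensive.

Import Order.TTheory GRing.Theory Num.Theory.
Import numFieldNormedType.Exports.

Local Open Scope ring_scope.
Local Open Scope complex_scope.

Section Hyperbolic.
Variable R : realType.

Definition cosh (x : R) : R := (expR x + expR (- x)) / 2.
Definition sinh (x : R) : R := (expR x - expR (- x)) / 2.
Definition tanh (x : R) : R := sinh x / cosh x.
Definition sech (x : R) : R := (cosh x)^-1.
Definition cot (x : R) : R := cos x / sin x.

End Hyperbolic.

Section Quaternions.
Variable R : realType.

Definition mx22 (a b c d : R[i]) : 'M[R[i]]_2 :=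
  \matrix_(i, j) (if i == 0 then (if j == 0 then a else b)
                  else (if j == 0 then c else d)).

Definition sigma1 : 'M[R[i]]_2 := mx22 0 1 1 0.
Definition sigma2 : 'M[R[i]]_2 := mx22 0 (- 'i%C) 'i%C 0.
Definition sigma3 : 'M[R[i]]_2 := mx22 1 0 0 (- 1).

Definition vec3 (x1 x2 x3 : R) : 'cV[R]_3 :=
  \col_(j < 3) nth 0 [:: x1; x2; x3] j.

(* R^3 inside the quaternions, as the trace-free ones. *)
Definition quat_of_vec (v : 'cV[R]_3) : 'M[R[i]]_2 :=
  (v 0 0)%:C *: (- 'i%C *: sigma1) + (v 1 0)%:C *: (- 'i%C *: sigma2)
  + (v 2%:R 0)%:C *: (- 'i%C *: sigma3).

Definition tracefree (X : 'M[R[i]]_2) : 'M[R[i]]_2 := X - (\tr X / 2)%:M.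

End Quaternions.

Section Nets.
Variable R : realType.

(* A frame depends on the lattice point and on t, where lambda = e^t. *)
Definition frame_family := int -> int -> R -> 'M[R[i]]_2.

Definition spectral (t : R) : R[i] := (expR t)%:C.

(* Entrywise derivative, taken on real and imaginary parts. *)
Definition derivemx (F : R -> 'M[R[i]]_2) (t : R) : 'M[R[i]]_2 :=
  \matrix_(i, j) (derive1 (fun u => complex.Re (F u i j)) t
                  +i* derive1 (fun u => complex.Im (F u i j)) t).

Definition net (Phi : frame_family) (k l : int) (t : R) : 'M[R[i]]_2 :=
  2%:R *: tracefree (invmx (Phi k l t) *m derivemx (Phi k l) t).

Definition gauss_map (Phi : frame_family) (k l : int) (t : R) : 'M[R[i]]_2 :=
  - 'i%C *: (invmx (Phi k l t) *m sigma3 R *m Phi k l t).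

(* Both L and M have this shape: [e] is the value of the edge function, [s] and
   [s'] those of the vertex function at the two ends of the edge. *)
Definition lax (delta : R) (e s s' lambda : R[i]) : 'M[R[i]]_2 :=
  let c : R[i] := (cot (delta / 2))%:C in
  let a : R[i] := (tan (delta / 2))%:C in
  mx22 (c * (e / s) + a * (e * s'))    ('i%C * (lambda - s * s' / lambda))
       ('i%C * (lambda - (lambda * s * s')^-1)) (c * (s / e) + a * (e * s')^-1).

Definition laxL (delta1 : R) (s l : int -> int -> R[i]) (k n : int)
    (lambda : R[i]) : 'M[R[i]]_2 :=
  lax delta1 (l k n) (s k n) (s (k + 1) n) lambda.

Definition laxM (delta2 : R) (s m : int -> int -> R[i]) (k n : int)
    (lambda : R[i]) : 'M[R[i]]_2 :=
  lax delta2 (m k n) (s k n) (s k (n + 1)) lambda.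

Definition is_frame (delta1 delta2 : R) (s l m : int -> int -> R[i])
    (Phi : frame_family) : Prop :=
  forall (k n : int) (t : R),
    Phi (k + 1) n t = laxL delta1 s l k n (spectral t) *m Phi k n t /\
    Phi k (n + 1) t = laxM delta2 s m k n (spectral t) *m Phi k n t.

Definition unitary (g : int -> int -> R[i]) : Prop :=
  forall k n : int, `|g k n| = 1.

(* The common value of the vertex and edge functions of the straight line. *)
Definition line_fun (k n : int) : R[i] := (- 1) ^ n.

Definition backlundB (s0 sb sdb lambda : R[i]) : 'M[R[i]]_2 :=
  mx22 (sb * (sdb + s0^-1))                  ('i%C * (lambda - sdb * s0 / lambda))
       ('i%C * (lambda - (lambda * sdb * s0)^-1)) (sb^-1 * (sdb^-1 + s0)).

Definition kuenB (sb sdb : int -> int -> R[i]) (k n : int) (lambda : R[i]) :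
    'M[R[i]]_2 :=
  backlundB (line_fun k n) (sb k n) (sdb k n) lambda.

Definition kuen_transform (delta1 delta2 : R) (sb sdb : int -> int -> R[i]) :
    Prop :=
  [/\ unitary sb, unitary sdb, sb 0 0 = 'i%C, sdb 0 0 = 1 &
    exists l m : int -> int -> R[i],
      [/\ unitary l, unitary m &
        forall (k n : int) (lambda : R[i]), lambda != 0 ->
          kuenB sb sdb (k + 1) n lambda
              *m laxL delta1 line_fun line_fun k n lambda
            = laxL delta1 sdb l k n lambda *m kuenB sb sdb k n lambda /\
          kuenB sb sdb k (n + 1) lambda
              *m laxM delta2 line_fun line_fun k n lambda
            = laxM delta2 sdb m k n lambda *m kuenB sb sdb k n lambda]].

Definition is_kuen_frame (delta1 delta2 : R) (Phi : frame_family) : Prop :=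
  exists (sb sdb : int -> int -> R[i]) (Phi0 : frame_family),
    [/\ kuen_transform delta1 delta2 sb sdb,
        is_frame delta1 delta2 line_fun line_fun line_fun Phi0,
        forall t : R, Phi0 0 0 t = 1%:M &
        forall (k n : int) (t : R),
          Phi k n t = kuenB sb sdb k n (spectral t) *m Phi0 k n t].

End Nets.

Section Formulas.
Variables (R : realType) (delta1 delta2 : R).

Definition tau : R := ln ((1 - sin delta1) / (1 + sin delta1)).

Definition line_x (k n : int) (t : R) : R :=
  k%:~R * (cosh t * sin delta1 / (1 + sinh t ^+ 2 * sin delta1 ^+ 2))
  + n%:~R * (sinh t * sin delta2 * cos delta2
             / (1 + sinh t ^+ 2 * sin delta2 ^+ 2)).

Definition omega (k n : int) (t : R) : R[i] :=
  (('i%C + (sinh t * sin delta1)%:C) / ('i%C - (sinh t * sin delta1)%:C)) ^ k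
  * (('i%C + (cosh t * tan delta2)%:C) / ('i%C - (cosh t * tan delta2)%:C)) ^ n.

Definition f_line (k n : int) (t : R) : 'cV[R]_3 :=
  vec3 (- 2 * line_x k n t) 0 0.

Definition f_kuen (k n : int) (t : R) : 'cV[R]_3 :=
  let K : R := k%:~R * tau in
  let N : R := n%:~R in
  let w := omega k n t in
  f_line k n t +
  (2 * cosh K * sech t / (cosh K ^+ 2 + 4 * N ^+ 2 * tan delta2 ^+ 2)) *:
  vec3 (2 * N * tan delta2 * tanh t * sech K - sinh K)
       (2 * N * tan delta2 * complex.Im w * sech t
        - complex.Re w * (2 * N * tan delta2 * tanh t * tanh K + 1))
       (complex.Im w * (2 * N * tan delta2 * tanh t * tanh K + 1)
        + 2 * N * tan delta2 * complex.Re w * sech t).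

Definition kuen_D (k n : int) (t : R) : R :=
  (1 - sinh t ^+ 2) * cosh (k%:~R * tau) ^+ 2
  - 4 * n%:~R ^+ 2 * tan delta2 ^+ 2 * cosh t ^+ 2.

Definition kuen_E (k n : int) (t : R) : R :=
  4 * n%:~R * tan delta2 * cosh t - sinh t * sinh (2 * (k%:~R * tau)).

Definition n_kuen (k n : int) (t : R) : 'cV[R]_3 :=
  let K : R := k%:~R * tau in
  let N : R := n%:~R in
  let w := omega k n t in
  let D := kuen_D k n t in
  let E := kuen_E k n t in
  (sech t ^+ 2 / (cosh K ^+ 2 + 4 * N ^+ 2 * tan delta2 ^+ 2)) *:
  vec3 (2 * (2 * N * tan delta2 * cosh t * sinh K + sinh t * cosh K))
       (complex.Im w * D + complex.Re w * E)
       (complex.Re w * D - complex.Im w * E).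

End Formulas.

(* Main.v *)
Require Import Defs.
From mathcomp Require Import all_boot all_order all_algebra.
From mathcomp Require Import all_classical all_reals all_analysis.
From mathcomp Require Import ring.

(** The Lax matrices of the straight line lie in the commutative subfield of
    the quaternions spanned by the unit and [sigma1], a copy of the complex
    numbers.  Its frame is therefore the image of an explicit complex number
    [line_exp], a product of powers, whose logarithmic derivative gives the
    position on the line and whose quotient conjugate over itself is [omega].

    The equations that define the transform live on single edges.  Multiplying
    [sb] and [sdb] by the alternating sign of the line turns horizontal and
    vertical edges into one algebraic problem, up to a sign [s].  Comparing the
    powers of the spectral parameter eliminates the unknown edge function and
    leaves two equations ([edge_eqs]): a Moebius map carries the rescaled [sb]
    from one end of the edge to the other, and the Cayley transform of the
    rescaled [sdb] satisfies an equation that is affine in each of its two end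
    values.  Both can be solved in either direction along the edge, so the
    values at the origin determine the transform on the whole lattice
    ([edge_step]).  The solution is [tanh + i sech] at [k tau], and the
    imaginary number [2 i n (tan delta2) sech (k tau)].  Conversely the two
    equations restore the matrix identity, and comparing determinants shows
    that the edge function they produce is unitary ([edge_exists]).

    For this solution the transformation matrix is the product of a quaternion
    independent of [t] that commutes with [sigma3] and of a quaternion
    [dressing_core] whose coordinates are elementary ([dressing_quat]).  The
    first factor cancels both in the logarithmic derivative of the frame and in
    the conjugate of [sigma3].  What remains are two identities between real
    quaternions ([dressing_core_derive], [dressing_core_normal]); conjugation by
    the frame of the line then rotates the last two coordinates by [omega]
    ([quat_of_C_rotate]), which is the form of the announced formulas. *)

Set Implicit Arguments.
Unset Strict Implicit.
Unset Printing Implicit Defensive.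

Import Order.TTheory GRing.Theory Num.Theory.
Import numFieldNormedType.Exports.

Local Open Scope ring_scope.
Local Open Scope complex_scope.

(** * Real quaternions as two by two matrices *)

Section Quaternion.
Variable R : realType.
Implicit Types (a b c d x y z w : R) (u v : R[i]) (A : 'M[R[i]]_2).

Lemma mx22P (p q r s : R[i]) A :
  A 0 0 = p -> A 0 1 = q -> A 1 0 = r -> A 1 1 = s -> A = mx22 p q r s.
Proof.
move=> e00 e01 e10 e11; apply/matrixP => i j; rewrite !mxE.
by case: i => [] [|[|//]] hi; case: j => [] [|[|//]] hj /=;
  [rewrite -e00|rewrite -e01|rewrite -e10|rewrite -e11];
  congr (A _ _); apply: val_inj.
Qed.

Lemma mx22M (p q r s p' q' r' s' : R[i]) :
  mx22 p q r s *m mx22 p' q' r' s' =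
  mx22 (p * p' + q * r') (p * q' + q * s') (r * p' + s * r') (r * q' + s * s').
Proof. by apply: mx22P; rewrite !mxE !big_ord_recl big_ord0 addr0 !mxE. Qed.

Lemma mx22_scale (k p q r s : R[i]) :
  k *: mx22 p q r s = mx22 (k * p) (k * q) (k * r) (k * s).
Proof. by apply: mx22P; rewrite !mxE. Qed.

Lemma mx22_add (p q r s p' q' r' s' : R[i]) :
  mx22 p q r s + mx22 p' q' r' s' = mx22 (p + p') (q + q') (r + r') (s + s').
Proof. by apply: mx22P; rewrite !mxE. Qed.

Lemma mx22_inj (p q r s p' q' r' s' : R[i]) :
  mx22 p q r s = mx22 p' q' r' s' -> [/\ p = p', q = q', r = r' & s = s'].
Proof.
move=> /matrixP e; split.
- by have := e 0 0; rewrite !mxE.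
- by have := e 0 1; rewrite !mxE.
- by have := e 1 0; rewrite !mxE.
- by have := e 1 1; rewrite !mxE.
Qed.

(** The real coordinates with respect to the unit and the three matrices
    [- i sigma_j], in which products follow the rule of Hamilton. *)
Definition quat a b c d : 'M[R[i]]_2 :=
  mx22 (a -i* d) ((- c) -i* b) (c -i* b) (a +i* d).

Lemma quatM a b c d x y z w :
  quat a b c d *m quat x y z w =
  quat (a * x - b * y - c * z - d * w) (a * y + b * x + c * w - d * z)
       (a * z - b * w + c * x + d * y) (a * w + b * z - c * y + d * x).
Proof.
by rewrite mx22M; congr mx22; simpc; congr (_ +i* _)%C; ring.
Qed.

Lemma quatD a b c d x y z w :
  quat a b c d + quat x y z w = quat (a + x) (b + y) (c + z) (d + w).
Proof.
by rewrite mx22_add; congr mx22; simpc; congr (_ +i* _)%C; ring.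
Qed.

Lemma quatZ k a b c d :
  k%:C *: quat a b c d = quat (k * a) (k * b) (k * c) (k * d).
Proof.
by rewrite mx22_scale; congr mx22; simpc; congr (_ +i* _)%C; ring.
Qed.

Lemma quat1 : quat 1 0 0 0 = 1%:M.
Proof. by symmetry; apply: mx22P; rewrite !mxE /=; simpc. Qed.

Lemma quat_of_vecE x y z : quat_of_vec (vec3 x y z) = quat 0 x y z.
Proof.
rewrite /quat_of_vec /sigma1 /sigma2 /sigma3 !mx22_scale !mx22_add !mxE /=.
by congr mx22; simpc; congr (_ +i* _)%C; ring.
Qed.

Lemma tracefree_quat a b c d : tracefree (quat a b c d) = quat 0 b c d.
Proof.
have tr_quat : \tr (quat a b c d) / 2 = a%:C.
  rewrite /mxtrace !big_ord_recl big_ord0 addr0 !mxE /=.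
  have -> : a -i* d + (a +i* d) = a%:C * 2.
    by rewrite mulr_natr mulr2n; simpc; rewrite addNr.
  by rewrite mulfK // pnatr_eq0.
rewrite /tracefree tr_quat.
by apply: mx22P; rewrite !mxE /= ?mulr1n ?mulr0n; simpc; rewrite ?subrr.
Qed.

Lemma quat_unitmx a b c d :
  a ^+ 2 + b ^+ 2 + c ^+ 2 + d ^+ 2 != 0 -> quat a b c d \in unitmx.
Proof.
set N := (X in X != 0) => N0.
have : quat a b c d *m quat (a / N) (- b / N) (- c / N) (- d / N) = 1%:M.
  by rewrite quatM -quat1; congr quat; rewrite /N; field.
by case/mulmx1_unit.
Qed.

(** Complex numbers act as the quaternions spanned by the unit and [sigma1],
    the subfield that contains every Lax matrix of the straight line. *)
Definition quat_of_C u : 'M[R[i]]_2 := quat (complex.Re u) (- complex.Im u) 0 0.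

Lemma quat_of_CM u v : quat_of_C (u * v) = quat_of_C u *m quat_of_C v.
Proof.
by case: u v => [a b] [c d]; rewrite /quat_of_C quatM; simpc => /=; congr quat; ring.
Qed.

Lemma quat_of_C1 : quat_of_C 1 = 1%:M.
Proof. by rewrite /quat_of_C /= oppr0 quat1. Qed.

Lemma quat_of_CVr u : u != 0 -> quat_of_C u *m quat_of_C u^-1 = 1%:M.
Proof. by move=> u0; rewrite -quat_of_CM divff // quat_of_C1. Qed.

Lemma quat_of_CVl u : u != 0 -> quat_of_C u^-1 *m quat_of_C u = 1%:M.
Proof. by move=> u0; rewrite -quat_of_CM mulVf // quat_of_C1. Qed.

Lemma ReIm_sqr_neq0 u : u != 0 -> complex.Re u ^+ 2 + complex.Im u ^+ 2 != 0.
Proof.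
by case: u => a b; rewrite eq_complex /= paddr_eq0 ?sqr_ge0 // !sqrf_eq0.
Qed.

(** Conjugation by a quaternion of that subfield fixes the first axis and
    rotates the other two by the argument of [conj u / u]. *)
Lemma quat_of_C_rotate u s x y z : u != 0 ->
  let w := u^*%C / u in
  quat s x y z *m quat_of_C u =
  quat_of_C u *m quat s x (y * complex.Re w + z * complex.Im w)
                          (z * complex.Re w - y * complex.Im w).
Proof.
move=> /ReIm_sqr_neq0; case: u => a b /= N0.
rewrite /quat_of_C /=; simpc => /=; rewrite !quatM.
by congr quat; field.
Qed.

End Quaternion.

(** * Derivatives of complex and matrix valued functions of a real variable *)

Lemma int_shift_ind (P : int -> Prop) :
  P 0 -> (forall k, P k <-> P (k + 1)) -> forall k, P k.
Proof.
move=> P0 step; apply: int_ind => [|n Pn|n Pn]; first by [].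
  by rewrite -addn1 PoszD; exact: (step n).1.
by apply: (step _).2; rewrite -addn1 PoszD opprD subrK.
Qed.

Section Derivative.
Variable R : realType.
Implicit Types (F G : R -> R[i]) (t : R).

Definition is_Cderive F t (D : R[i]) : Prop :=
  is_derive t (1 : R) (fun u => complex.Re (F u)) (complex.Re D) /\
  is_derive t (1 : R) (fun u => complex.Im (F u)) (complex.Im D).

Definition is_mxderive (F : R -> 'M[R[i]]_2) t (D : 'M[R[i]]_2) : Prop :=
  forall i j, is_Cderive (fun u => F u i j) t (D i j).

Lemma derivemx_eq (F : R -> 'M[R[i]]_2) t D :
  is_mxderive F t D -> derivemx F t = D.
Proof.
move=> dF; apply/matrixP => i j; have [dRe dIm] := dF i j.
by rewrite mxE !derive1E !derive_val; case: (D i j).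
Qed.

Lemma is_Cderive_cst (c : R[i]) t : is_Cderive (fun=> c) t 0.
Proof. by split; exact: is_derive_cst. Qed.

Lemma complex_ReD (x y : R[i]) : complex.Re (x + y) = complex.Re x + complex.Re y.
Proof. by case: x y => [? ?] [? ?]. Qed.

Lemma complex_ImD (x y : R[i]) : complex.Im (x + y) = complex.Im x + complex.Im y.
Proof. by case: x y => [? ?] [? ?]. Qed.

Lemma is_CderiveD F G t D E : is_Cderive F t D -> is_Cderive G t E ->
  is_Cderive (fun u => F u + G u) t (D + E).
Proof.
move=> [dF eF] [dG eG]; split.
  under eq_fun do rewrite complex_ReD.
  by rewrite complex_ReD; exact: (is_deriveD dF dG).
under eq_fun do rewrite complex_ImD.
by rewrite complex_ImD; exact: (is_deriveD eF eG).
Qed.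

Lemma complex_ReM (x y : R[i]) : complex.Re (x * y) =
  complex.Re x * complex.Re y - complex.Im x * complex.Im y.
Proof. by case: x y => [? ?] [? ?]. Qed.

Lemma complex_ImM (x y : R[i]) : complex.Im (x * y) =
  complex.Re x * complex.Im y + complex.Im x * complex.Re y.
Proof. by case: x y => [? ?] [? ?]. Qed.

Lemma is_CderiveM F G t D E : is_Cderive F t D -> is_Cderive G t E ->
  is_Cderive (fun u => F u * G u) t (D * G t + F t * E).
Proof.
move=> [dF eF] [dG eG]; split.
  under eq_fun do rewrite complex_ReM.
  apply: (is_derive_eq (is_deriveB (is_deriveM dF dG) (is_deriveM eF eG))).
  case: (F t) (G t) (D) (E) => [? ?] [? ?] [? ?] [? ?] /=.
  by rewrite /GRing.scale /=; ring.
under eq_fun do rewrite complex_ImM.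
apply: (is_derive_eq (is_deriveD (is_deriveM dF eG) (is_deriveM eF dG))).
case: (F t) (G t) (D) (E) => [? ?] [? ?] [? ?] [? ?] /=.
by rewrite /GRing.scale /=; ring.
Qed.

Lemma is_mxderiveM (F G : R -> 'M[R[i]]_2) t D E :
  is_mxderive F t D -> is_mxderive G t E ->
  is_mxderive (fun u => F u *m G u) t (D *m G t + F t *m E).
Proof.
move=> dF dG i j.
have entryM (A B : 'M[R[i]]_2) : (A *m B) i j = A i 0 * B 0 j + A i 1 * B 1 j.
  rewrite mxE !big_ord_recl big_ord0 addr0.
  by rewrite (_ : lift ord0 ord0 = 1) //; apply: val_inj.
have := is_CderiveD (is_CderiveM (dF i 0) (dG 0 j)) (is_CderiveM (dF i 1) (dG 1 j)).
rewrite addrACA -!entryM [X in _ -> is_Cderive _ _ X]mxE.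
by under [in X in _ -> X]eq_fun do rewrite entryM.
Qed.

Lemma is_mxderive_cst (A : 'M[R[i]]_2) t : is_mxderive (fun=> A) t 0.
Proof. by move=> i j; rewrite mxE; exact: is_Cderive_cst. Qed.

Lemma is_mxderive_quat (a b c d : R -> R) t a' b' c' d' :
  is_derive t (1 : R) a a' -> is_derive t (1 : R) b b' ->
  is_derive t (1 : R) c c' -> is_derive t (1 : R) d d' ->
  is_mxderive (fun u => quat (a u) (b u) (c u) (d u)) t (quat a' b' c' d').
Proof.
move=> da db dc dd i j.
have entryE x y z w : quat x y z w i j =
    if i == 0 then (if j == 0 then x -i* w else (- z) -i* y)
    else (if j == 0 then z -i* y else x +i* w) by rewrite mxE.
under eq_fun do rewrite entryE.
by rewrite entryE; case: (i == 0); case: (j == 0); split => /=; try exact: is_deriveN.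
Qed.

Lemma is_mxderive_quat_of_C F t D :
  is_Cderive F t D -> is_mxderive (fun u => quat_of_C (F u)) t (quat_of_C D).
Proof.
move=> [dRe dIm].
by apply: is_mxderive_quat (is_deriveN dIm) _ _ => //; exact: is_derive_cst.
Qed.


Lemma invC_ReIm (x : R[i]) : x^-1 =
  (complex.Re x / (complex.Re x ^+ 2 + complex.Im x ^+ 2))
  -i* (complex.Im x / (complex.Re x ^+ 2 + complex.Im x ^+ 2)).
Proof. by case: x => a b /=. Qed.

Lemma is_CderiveV F t D : F t != 0 -> is_Cderive F t D ->
  is_Cderive (fun u => (F u)^-1) t (- D / F t ^+ 2).
Proof.
move=> Ft0 [dRe dIm].
have N0 := ReIm_sqr_neq0 Ft0.
have dNV : is_derive t (1 : R)
    (fun u => (complex.Re (F u) ^+ 2 + complex.Im (F u) ^+ 2)^-1)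
    (- (2 * (complex.Re (F t) * complex.Re D + complex.Im (F t) * complex.Im D))
     / (complex.Re (F t) ^+ 2 + complex.Im (F t) ^+ 2) ^+ 2).
  have dN : is_derive t (1 : R)
      (fun u => complex.Re (F u) ^+ 2 + complex.Im (F u) ^+ 2)
      (2 * (complex.Re (F t) * complex.Re D + complex.Im (F t) * complex.Im D)).
    apply: (is_derive_eq (is_deriveD (is_deriveM dRe dRe) (is_deriveM dIm dIm))).
    by rewrite /GRing.scale /=; ring.
  have dV := @is_deriveV R
    (fun u => complex.Re (F u) ^+ 2 + complex.Im (F u) ^+ 2) t _ 1 N0 dN.
  apply: (is_derive_eq dV).
  by rewrite /GRing.scale /=; field.
have -> : - D / F t ^+ 2 =
    (- (D * (F t)^*%C ^+ 2)) / ((complex.Re (F t) ^+ 2 + complex.Im (F t) ^+ 2) ^+ 2)%:C.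
  have -> : ((complex.Re (F t) ^+ 2 + complex.Im (F t) ^+ 2) ^+ 2)%:C
      = F t ^+ 2 * (F t)^*%C ^+ 2.
    rewrite -exprMn [LHS]rmorphXn; congr (_ ^+ 2).
    by case: (F t) => a b /=; simpc; congr (_ +i* _)%C; ring.
  by field; rewrite conjc_eq0 Ft0.
rewrite -fmorphV /=.
split.
  under eq_fun do rewrite invC_ReIm /=.
  apply: (is_derive_eq (is_deriveM dRe dNV)) => /=.
  case: (F t) (D) N0 => [a b] [c d] /= N0.
  rewrite /GRing.scale /=; simpc => /=; field; exact: N0.
under eq_fun do rewrite invC_ReIm /=.
apply: (is_derive_eq (is_deriveN (is_deriveM dIm dNV))) => /=.
case: (F t) (D) N0 => [a b] [c d] /= N0.
rewrite /GRing.scale /=; simpc => /=; field; exact: N0.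
Qed.

(** In terms of logarithmic derivatives the rule for powers is linear in the
    exponent, so that positive and negative powers are treated alike. *)
Lemma is_Cderive_exprz F t h k : (forall u, F u != 0) ->
  is_Cderive F t (F t * h) ->
  is_Cderive (fun u => F u ^ k) t (F t ^ k * (k%:~R * h)).
Proof.
move=> F0 dF; elim/int_shift_ind: k => [|k].
  under eq_fun do rewrite expr0z.
  by rewrite mul0r mulr0; exact: is_Cderive_cst.
split=> dFk.
  under eq_fun do rewrite exprzDr ?unitfE // expr1z.
  have := is_CderiveM dFk dF; congr is_Cderive.
  by rewrite exprzDr ?unitfE // expr1z intrD; ring.
have -> : (fun u => F u ^ k) = (fun u => F u ^ (k + 1) * (F u)^-1).
  by apply/funext => u; rewrite exprzDr ?unitfE // expr1z mulfK.
have := is_CderiveM dFk (is_CderiveV (F0 t) dF); congr is_Cderive.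
by rewrite exprzDr ?unitfE // expr1z intrD; field; exact: F0.
Qed.

End Derivative.

(** * Hyperbolic functions and half angles *)

Section RealFunctions.
Variable R : realType.
Implicit Types (x t delta : R).

Lemma cosh_gt0 x : 0 < cosh x.
Proof. by rewrite divr_gt0 // addr_gt0 ?expR_gt0. Qed.

Lemma cosh2_sub_sinh2 x : cosh x ^+ 2 - sinh x ^+ 2 = 1.
Proof.
by rewrite /cosh /sinh expRN; field; rewrite gt_eqF ?expR_gt0.
Qed.

Lemma is_derive_expRN t :
  is_derive t (1 : R) (fun u => expR (- u)) (- expR (- t)).
Proof.
have /= dN := is_deriveN (is_derive_id t (1 : R)).
have dE := is_derive_expR (- t).
have := @is_derive1_comp R expR (fun u => - u) t _ _ dE dN.
by move=> h; apply: (is_derive_eq h); rewrite ?mulrN1 ?mulN1r.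
Qed.

Lemma is_derive_sinh t : is_derive t (1 : R) (@sinh R) (cosh t).
Proof.
have -> : @sinh R = (2^-1 \*: (expR \- (fun u => expR (- u))))%R.
  by apply/funext => u /=; rewrite /sinh mulrC.
apply: (is_derive_eq (is_deriveZ _ (is_deriveB (is_derive_expR t) (is_derive_expRN t)))).
by rewrite /cosh /GRing.scale /=; field.
Qed.

Lemma is_derive_cosh t : is_derive t (1 : R) (@cosh R) (sinh t).
Proof.
have -> : @cosh R = (2^-1 \*: (expR \+ (fun u => expR (- u))))%R.
  by apply/funext => u /=; rewrite /cosh mulrC.
apply: (is_derive_eq (is_deriveZ _ (is_deriveD (is_derive_expR t) (is_derive_expRN t)))).
by rewrite /sinh /GRing.scale /=; field.
Qed.

Lemma sin_half_double delta : sin delta = 2 * sin (delta / 2) * cos (delta / 2).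
Proof.
have {1}-> : delta = delta / 2 + delta / 2 by field.
by rewrite sinD; ring.
Qed.

Lemma sin_half_neq0 delta : sin delta != 0 ->
  sin (delta / 2) != 0 /\ cos (delta / 2) != 0.
Proof.
by rewrite sin_half_double !mulf_eq0 !negb_or => /andP[/andP[_ -> ->]].
Qed.

Lemma cot_half_neq0 delta : sin delta != 0 -> cot (delta / 2) != 0.
Proof.
by move=> /sin_half_neq0[s0 c0]; rewrite /cot mulf_neq0 ?invr_neq0.
Qed.

Lemma tan_half delta : sin delta != 0 -> tan (delta / 2) = (cot (delta / 2))^-1.
Proof. by move=> /sin_half_neq0[s0 c0]; rewrite /tan /cot invf_div. Qed.

Lemma cot_add_tan_half delta : sin delta != 0 ->
  cot (delta / 2) + tan (delta / 2) = 2 / sin delta.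
Proof.
move=> d0; have [s0 c0] := sin_half_neq0 d0.
rewrite sin_half_double /tan /cot.
transitivity ((cos (delta / 2) ^+ 2 + sin (delta / 2) ^+ 2)
              / (sin (delta / 2) * cos (delta / 2))).
  by field; rewrite s0 c0.
by rewrite cos2Dsin2; field; rewrite s0 c0.
Qed.

Lemma cot_sub_tan_half delta : sin delta != 0 ->
  cot (delta / 2) - tan (delta / 2) = 2 * cos delta / sin delta.
Proof.
move=> d0; have [s0 c0] := sin_half_neq0 d0.
have -> : cos delta = cos (delta / 2) ^+ 2 - sin (delta / 2) ^+ 2.
  have {1}-> : delta = delta / 2 + delta / 2 by field.
  by rewrite cosD !expr2.
by rewrite (sin_half_double delta) /tan /cot; field; rewrite s0 c0.
Qed.

Lemma spectralB t : spectral t - (spectral t)^-1 = (2 * sinh t)%:C.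
Proof.
rewrite /spectral -fmorphV -rmorphB /sinh expRN /=; congr (_%:C).
by field; rewrite gt_eqF ?expR_gt0.
Qed.

Lemma spectralD t : spectral t + (spectral t)^-1 = (2 * cosh t)%:C.
Proof.
rewrite /spectral -fmorphV -rmorphD /cosh expRN /=; congr (_%:C).
by field; rewrite gt_eqF ?expR_gt0.
Qed.

End RealFunctions.

(** * The frame of the straight line *)

Section Line.
Variables (R : realType) (delta1 delta2 : R).
Hypotheses (sin1_neq0 : sin delta1 != 0) (sin2_neq0 : sin delta2 != 0).
Hypothesis cos2_neq0 : cos delta2 != 0.
Implicit Types (k n : int) (t : R).

Lemma line_funS k n : line_fun R k (n + 1) = - line_fun R k n.
Proof. by rewrite /line_fun exprzDr ?unitrN1 // expr1z mulrN1. Qed.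

Lemma line_fun_sqr k n : line_fun R k n * line_fun R k n = 1.
Proof. by rewrite /line_fun -exprzMl ?unitrN1 // mulrNN mulr1 exp1rz. Qed.

Lemma line_funV k n : (line_fun R k n)^-1 = line_fun R k n.
Proof.
have e2 := line_fun_sqr k n; rewrite -[LHS]mul1r -{1}e2 mulfK //.
by apply: contra_eq_neq e2 => ->; rewrite mul0r eq_sym oner_eq0.
Qed.

Lemma line_fun_neq0 k n : line_fun R k n != 0.
Proof.
by apply: contra_eq_neq (line_fun_sqr k n) => ->; rewrite mul0r eq_sym oner_eq0.
Qed.

Lemma laxL_line k n (lambda : R[i]) :
  laxL delta1 (@line_fun R) (@line_fun R) k n lambda =
  mx22 (2 / sin delta1)%:C ('i%C * (lambda - lambda^-1))
       ('i%C * (lambda - lambda^-1)) (2 / sin delta1)%:C.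
Proof.
have e2 := line_fun_sqr k n; have e0 := line_fun_neq0 k n.
rewrite /laxL /lax (_ : line_fun R (k + 1) n = line_fun R k n) //.
have -> : lambda * line_fun R k n * line_fun R k n = lambda.
  by rewrite -mulrA e2 mulr1.
rewrite divff // e2 invr1 !mulr1 mul1r.
by rewrite -(cot_add_tan_half sin1_neq0) rmorphD.
Qed.

Lemma laxM_line k n (lambda : R[i]) :
  laxM delta2 (@line_fun R) (@line_fun R) k n lambda =
  mx22 (2 * cos delta2 / sin delta2)%:C ('i%C * (lambda + lambda^-1))
       ('i%C * (lambda + lambda^-1)) (2 * cos delta2 / sin delta2)%:C.
Proof.
have e2 := line_fun_sqr k n; have e0 := line_fun_neq0 k n.
rewrite /laxM /lax line_funS.
have -> : lambda * line_fun R k n * (- line_fun R k n) = - lambda.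
  by rewrite mulrN -mulrA e2 mulr1.
rewrite divff // mulrN e2 !invrN invr1 mulr1 mulrN1 mulN1r !opprK.
by rewrite -(cot_sub_tan_half sin2_neq0) rmorphB.
Qed.

Definition line_u t : R[i] := (2 / sin delta1) +i* (2 * sinh t).
Definition line_v t : R[i] := (2 * cos delta2 / sin delta2) +i* (2 * cosh t).
Definition line_exp k n t : R[i] := line_u t ^ k * line_v t ^ n.

Lemma line_u_neq0 t : line_u t != 0.
Proof. by rewrite eq_complex /= mulf_eq0 invr_eq0 (negPf sin1_neq0) pnatr_eq0. Qed.

Lemma line_v_neq0 t : line_v t != 0.
Proof.
by rewrite eq_complex /= !mulf_eq0 invr_eq0 (negPf sin2_neq0) (negPf cos2_neq0) pnatr_eq0.
Qed.

Lemma line_exp_neq0 k n t : line_exp k n t != 0.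
Proof. by rewrite mulf_neq0 // expfz_neq0 ?line_u_neq0 ?line_v_neq0. Qed.

Lemma line_expSl k n t : line_exp (k + 1) n t = line_u t * line_exp k n t.
Proof. by rewrite /line_exp exprzDr ?unitfE ?line_u_neq0 // expr1z mulrAC mulrC. Qed.

Lemma line_expSr k n t : line_exp k (n + 1) t = line_v t * line_exp k n t.
Proof. by rewrite /line_exp exprzDr ?unitfE ?line_v_neq0 // expr1z mulrA mulrC. Qed.

Lemma laxL_line_quat k n t :
  laxL delta1 (@line_fun R) (@line_fun R) k n (spectral t) = quat_of_C (line_u t).
Proof.
by rewrite laxL_line spectralB /quat_of_C /quat /=; congr mx22; simpc.
Qed.

Lemma laxM_line_quat k n t :
  laxM delta2 (@line_fun R) (@line_fun R) k n (spectral t) = quat_of_C (line_v t).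
Proof.
by rewrite laxM_line spectralD /quat_of_C /quat /=; congr mx22; simpc.
Qed.

(** The matrices of the recursion are invertible, hence the frame is determined
    on the whole lattice, not only for nonnegative indices. *)
Lemma line_frameP (Phi0 : frame_family R) :
  (is_frame delta1 delta2 (@line_fun R) (@line_fun R) (@line_fun R) Phi0 /\
   forall t, Phi0 0 0 t = 1%:M) <->
  (forall k n t, Phi0 k n t = quat_of_C (line_exp k n t)).
Proof.
split=> [[frame Phi0_1]|Phi0E].
  have stepL k n t : Phi0 (k + 1) n t = quat_of_C (line_u t) *m Phi0 k n t.
    by rewrite -(laxL_line_quat k n); exact: (frame k n t).1.
  have stepM k n t : Phi0 k (n + 1) t = quat_of_C (line_v t) *m Phi0 k n t.
    by rewrite -(laxM_line_quat k n); exact: (frame k n t).2.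
  have cancel u (X Y : 'M[R[i]]_2) : u != 0 ->
      quat_of_C u *m X = quat_of_C u *m Y -> X = Y.
    move=> u0 /(congr1 (mulmx (quat_of_C u^-1))).
    by rewrite !mulmxA quat_of_CVl // !mul1mx.
  move=> k n t; elim/int_shift_ind: n k => [|n]; last first.
    split=> IH k.
      by rewrite stepM line_expSr quat_of_CM IH.
    by apply: (cancel _ _ _ (line_v_neq0 t)); rewrite -stepM -quat_of_CM -line_expSr.
  elim/int_shift_ind => [|k].
    by rewrite Phi0_1 /line_exp !expr0z mulr1 quat_of_C1.
  split=> IH; first by rewrite stepL line_expSl quat_of_CM IH.
  by apply: (cancel _ _ _ (line_u_neq0 t)); rewrite -stepL -quat_of_CM -line_expSl.
split=> [k n t|t]; last by rewrite Phi0E /line_exp !expr0z mulr1 quat_of_C1.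
rewrite laxL_line_quat laxM_line_quat !Phi0E.
by rewrite line_expSl line_expSr !quat_of_CM.
Qed.

Lemma line_exp_omega k n t :
  (line_exp k n t)^*%C / line_exp k n t = omega delta1 delta2 k n t.
Proof.
have conj_line : (line_exp k n t)^*%C = (line_u t)^*%C ^ k * (line_v t)^*%C ^ n.
  by rewrite rmorphM /= !(fmorphXz conjc).
have expz_div (x y x' y' : R[i]) :
    x ^ k * y ^ n / (x' ^ k * y' ^ n) = (x / x') ^ k * (y / y') ^ n.
  by rewrite invfM mulrACA !expfzMl !exprz_inv !invr_expz.
rewrite conj_line /line_exp expz_div /omega.
have frac_eq (x y x' y' : R[i]) : y != 0 -> y' != 0 -> x * y' = x' * y ->
    x / y = x' / y'.
  by move=> y0 y'0 e; apply/eqP; rewrite eqr_div // e.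
have i_sub_neq0 (a : R) : 'i%C - a%:C != 0 :> R[i].
  by rewrite eq_complex /= subr0 oner_eq0 andbF.
have omega1 := frac_eq (line_u t)^*%C _ ('i%C + (sinh t * sin delta1)%:C) _
  (line_u_neq0 t) (i_sub_neq0 (sinh t * sin delta1)).
have omega2 := frac_eq (line_v t)^*%C _ ('i%C + (cosh t * tan delta2)%:C) _
  (line_v_neq0 t) (i_sub_neq0 (cosh t * tan delta2)).
have e1 : (line_u t)^*%C / line_u t
    = ('i%C + (sinh t * sin delta1)%:C) / ('i%C - (sinh t * sin delta1)%:C).
  apply: omega1; rewrite /line_u; simpc => /=; congr (_ +i* _)%C; field;
    exact: sin1_neq0.
have e2 : (line_v t)^*%C / line_v t
    = ('i%C + (cosh t * tan delta2)%:C) / ('i%C - (cosh t * tan delta2)%:C).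
  apply: omega2; rewrite /line_v /tan; simpc => /=; congr (_ +i* _)%C; field;
    by rewrite cos2_neq0 sin2_neq0.
rewrite e1 e2.
reflexivity.
Qed.

Definition line_log_deriv k n t : R[i] :=
  k%:~R * ((0 +i* (2 * cosh t)) / line_u t)
  + n%:~R * ((0 +i* (2 * sinh t)) / line_v t).

Lemma is_Cderive_line_exp k n t :
  is_Cderive (line_exp k n) t (line_exp k n t * line_log_deriv k n t).
Proof.
have du : is_Cderive line_u t (line_u t * ((0 +i* (2 * cosh t)) / line_u t)).
  rewrite mulrC divfK ?line_u_neq0 //; split=> /=.
    exact: is_derive_cst.
  by apply: (is_derive_eq (is_deriveZ 2 (is_derive_sinh t))).
have dv : is_Cderive line_v t (line_v t * ((0 +i* (2 * sinh t)) / line_v t)).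
  rewrite mulrC divfK ?line_v_neq0 //; split=> /=.
    exact: is_derive_cst.
  by apply: (is_derive_eq (is_deriveZ 2 (is_derive_cosh t))).
have := is_CderiveM (is_Cderive_exprz k line_u_neq0 du)
                    (is_Cderive_exprz n line_v_neq0 dv).
congr is_Cderive; rewrite /line_exp /line_log_deriv.
move: (line_u t ^ k) (line_v t ^ n) (_ / line_u t) (_ / line_v t) => x y hx hy.
by ring.
Qed.

Lemma Im_intM (m : int) (z : R[i]) : complex.Im (m%:~R * z) = m%:~R * complex.Im z.
Proof.
have -> : m%:~R = (m%:~R)%:C :> R[i] by rewrite rmorph_int.
by rewrite complex_ImM /= mul0r addr0.
Qed.

(** Of the logarithmic derivative only the imaginary part, the coordinate along
    the line, is trace free. *)
Lemma Im_line_log_deriv k n t :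
  complex.Im (line_log_deriv k n t) = line_x delta1 delta2 k n t.
Proof.
have Im_iV (a b c : R) :
    complex.Im ((0 +i* c) / (a +i* b)) = c * a / (a ^+ 2 + b ^+ 2).
  by rewrite complex_ImM invC_ReIm /= mul0r add0r mulrA.
have pos (a b : R) : 1 + a ^+ 2 * b ^+ 2 != 0.
  by rewrite gt_eqF // ltr_pwDl // -exprMn sqr_ge0.
have c2 : cos delta2 ^+ 2 = 1 - sin delta2 ^+ 2.
  by rewrite -(cos2Dsin2 delta2) addrK.
have ch2 : cosh t ^+ 2 = 1 + sinh t ^+ 2 by rewrite -(cosh2_sub_sinh2 t) subrK.
rewrite /line_log_deriv complex_ImD !Im_intM /line_x !Im_iV; congr (_ * _ + _ * _).
  have -> : (2 / sin delta1) ^+ 2 + (2 * sinh t) ^+ 2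
      = 4 / sin delta1 ^+ 2 * (1 + sinh t ^+ 2 * sin delta1 ^+ 2) by field.
  move: (1 + sinh t ^+ 2 * _) (pos (sinh t) (sin delta1)) => q q0.
  by field; rewrite ?q0 ?sin1_neq0.
have -> : (2 * cos delta2 / sin delta2) ^+ 2 + (2 * cosh t) ^+ 2
    = 4 / sin delta2 ^+ 2 * (1 + sinh t ^+ 2 * sin delta2 ^+ 2).
  have -> : (2 * cosh t) ^+ 2 = 4 * (1 + sinh t ^+ 2) by rewrite -ch2; ring.
  have -> : (2 * cos delta2 / sin delta2) ^+ 2
      = 4 * (1 - sin delta2 ^+ 2) / sin delta2 ^+ 2 by rewrite -c2; field.
  by field.
move: (1 + sinh t ^+ 2 * _) (pos (sinh t) (sin delta2)) => q q0.
by field; rewrite ?q0 ?sin2_neq0.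
Qed.

End Line.

(** * The Baecklund transformation along one edge *)

Section Edge.
Variable R : realType.
Implicit Types (A s b D X Y z lambda : R[i]).

(** On a horizontal edge [s = 1] and on a vertical one [s = - 1]: [s] is the
    product of the values of the straight line at the two ends. *)
Definition line_edge A s lambda : 'M[R[i]]_2 :=
  mx22 A ('i%C * (lambda - s / lambda)) ('i%C * (lambda - s / lambda)) A.

(** The matrix of the double transform, in terms of [sb] and [sdb] multiplied by
    the sign of the straight line, so that this sign is absorbed. *)
Definition dressing b D lambda : 'M[R[i]]_2 :=
  mx22 (b * (1 + D)) ('i%C * (lambda - D / lambda))
       ('i%C * (lambda - (lambda * D)^-1)) ((1 + D^-1) / b).

(** The only value that the coefficient of [lambda] in the upper right entry of
    the matrix identity leaves for the upper left entry of the transformed Lax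
    matrix. *)
Definition edge_entry A b b1 D D1 : R[i] :=
  b1 * (1 + D1) + A - (1 + D^-1) / b.

(** At [lambda = 'i] the matrix [dressing b D lambda] has rank one, unless
    [D = - 1], and its kernel is spanned by the column (1, [b]).  The identity between the matrices
    forces the matrix of the line to map one kernel into the other, which is the
    following Moebius relation. *)
Definition angle_eq A s b b1 : Prop := b1 * (A - (1 + s) * b) = A * b - (1 + s).

(** What the coefficient of the inverse of [lambda] in the upper right entry of
    the matrix identity says, once [edge_entry] has replaced the unknown. *)
Definition vertex_eq A s b b1 D D1 : Prop :=
  b1 * (1 + D1) * (D - s) + A * (D - D1) = (1 + D) * (1 - s * D1) / b.

(** [vertex_eq] in the coordinates [z] for which [D] is the quotient of
    [1 + z] by [1 - z]. *)
Definition cayley_eq A s b b1 z z1 : Prop :=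
  b1 * ((1 - s) + (1 + s) * z) + A * (z - z1) = ((1 - s) - (1 + s) * z1) / b.

Lemma mul_i_i (x y : R[i]) : ('i%C * x) * ('i%C * y) = - (x * y).
Proof. by rewrite mulrACA -expr2 sqr_i mulN1r. Qed.

Section EdgeSign.
Variables (A s : R[i]).
Hypothesis s_sqr : s * s = 1.

Lemma edge_sign : s = 1 \/ s = - 1.
Proof.
have /eqP : (s - 1) * (s + 1) = 0 by rewrite mulrDr mulr1 mulrDl mulN1r s_sqr; ring.
rewrite mulf_eq0 subr_eq0 addr_eq0 => /orP[]/eqP; by [left|right].
Qed.

(** Sufficiency of the two equations, for the first row of the matrix identity.
    The second row is the same statement for the inverses of
    [b], [b1], [D] and [D1]. *)
Lemma edge_row b b1 D D1 lambda : b != 0 -> D != 0 -> lambda != 0 ->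
  angle_eq A s b b1 -> vertex_eq A s b b1 D D1 ->
  b1 * (1 + D1) * A + ('i%C * (lambda - D1 / lambda)) * ('i%C * (lambda - s / lambda))
  = edge_entry A b b1 D D1 * (b * (1 + D))
    + ('i%C * (lambda - D * (s * D1) / lambda)) * ('i%C * (lambda - (lambda * D)^-1))
  /\
  b1 * (1 + D1) * ('i%C * (lambda - s / lambda)) + ('i%C * (lambda - D1 / lambda)) * A
  = edge_entry A b b1 D D1 * ('i%C * (lambda - D / lambda))
    + ('i%C * (lambda - D * (s * D1) / lambda)) * ((1 + D^-1) / b).
Proof.
move=> b0 D0 l0; rewrite /angle_eq /vertex_eq => /eqP; rewrite -subr_eq0 => /eqP ha.
move=> /eqP; rewrite -subr_eq0 => /eqP hb; split; apply/eqP; rewrite -subr_eq0; apply/eqP.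
  rewrite !mul_i_i.
  (* The powers of lambda other than the constant one agree identically. *)
  transitivity ((1 + D1) * (b1 * (A - (1 + s) * b) - (A * b - (1 + s)))
     - b * (b1 * (1 + D1) * (D - s) + A * (D - D1) - (1 + D) * (1 - s * D1) / b)).
    rewrite /edge_entry; case: edge_sign => ->; field; by rewrite ?b0 ?D0 ?l0.
  by rewrite ha hb !mulr0 subrr.
transitivity ('i%C / lambda *
     (b1 * (1 + D1) * (D - s) + A * (D - D1) - (1 + D) * (1 - s * D1) / b)).
  rewrite /edge_entry; field; by rewrite ?b0 ?D0 ?l0.
by rewrite hb mulr0.
Qed.

(** Necessity of the two equations.  Only the first row of the identity enters,
    so the second row of the transformed matrix can be left unspecified. *)
Lemma edge_eqs b b1 D D1 X x y : b != 0 -> D != 0 ->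
  (forall lambda, lambda != 0 ->
    dressing b1 D1 lambda *m line_edge A s lambda =
    mx22 X ('i%C * (lambda - D * (s * D1) / lambda)) (x lambda) (y lambda)
      *m dressing b D lambda) ->
  (1 + D1) * (b1 * (A - (1 + s) * b) - (A * b - (1 + s))) = 0
  /\ vertex_eq A s b b1 D D1.
Proof.
move=> b0 D0 compat.
have row lambda : lambda != 0 ->
  b1 * (1 + D1) * A + ('i%C * (lambda - D1 / lambda)) * ('i%C * (lambda - s / lambda))
  = X * (b * (1 + D))
    + ('i%C * (lambda - D * (s * D1) / lambda)) * ('i%C * (lambda - (lambda * D)^-1))
  /\
  b1 * (1 + D1) * ('i%C * (lambda - s / lambda)) + ('i%C * (lambda - D1 / lambda)) * A
  = X * ('i%C * (lambda - D / lambda))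
    + ('i%C * (lambda - D * (s * D1) / lambda)) * ((1 + D^-1) / b).
  by move=> /compat; rewrite /dressing /line_edge !mx22M => /mx22_inj[].
have i0 : 'i%C != 0 :> R[i] by rewrite eq_complex /= eqxx oner_eq0.
have two0 : 2 != 0 :> R[i] by rewrite pnatr_eq0.
have off (lambda : R[i]) : lambda != 0 ->
    (b1 * (1 + D1) + A - X - (1 + D^-1) / b) * lambda
    + (X * D + D * (s * D1) * (1 + D^-1) / b - s * b1 * (1 + D1) - D1 * A) / lambda = 0.
  move=> l0; have [_ /eqP] := row _ l0; rewrite -subr_eq0 => /eqP e.
  apply: (mulfI i0); rewrite mulr0 -[RHS]e; field; by rewrite l0 b0 D0.
(* The two coefficients of [off] vanish, because they do so in the values at 1
   and at 2. *)
have [e00 _] := row 1 (oner_neq0 _).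
have e1 := off 1 (oner_neq0 _); have e2 := off 2 two0.
have three0 : 3 != 0 :> R[i] by rewrite pnatr_eq0.
move: e1 e2; set p := (X in X * 1 + _); set q := (X in _ + X / 1) => e1 e2.
have p0 : p = 0.
  apply: (mulfI three0); rewrite mulr0.
  transitivity (2 * (p * 2 + q / 2) - (p * 1 + q / 1)); first by field.
  by rewrite e1 e2 mulr0 subr0.
have q0 : q = 0.
  by move: e1; rewrite p0 mul0r add0r divr1.
have XE : X = b1 * (1 + D1) + A - (1 + D^-1) / b.
  apply/eqP; rewrite eq_sym -subr_eq0; apply/eqP; rewrite -[RHS]p0 /p; ring.
have hb : vertex_eq A s b b1 D D1.
  apply/eqP; rewrite -subr_eq0; apply/eqP; rewrite -[RHS]q0 /q XE; field.
  by rewrite b0 D0.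
split=> //.
move/eqP: e00; rewrite -subr_eq0 => /eqP e00.
move/eqP: hb; rewrite -subr_eq0 => /eqP hb.
transitivity (b1 * (1 + D1) * A + ('i%C * (1 - D1 / 1)) * ('i%C * (1 - s / 1))
  - (X * (b * (1 + D)) + ('i%C * (1 - D * (s * D1) / 1)) * ('i%C * (1 - (1 * D)^-1)))
  + b * (b1 * (1 + D1) * (D - s) + A * (D - D1) - (1 + D) * (1 - s * D1) / b)).
  rewrite !mul_i_i XE; field; by rewrite b0 D0.
by rewrite e00 hb mulr0 addr0.
Qed.

End EdgeSign.
End Edge.

Section EdgeUnitary.
Variable R : realType.
Implicit Types (b D X Y z lambda : R[i]).

Lemma norm1_neq0 (x : R[i]) : `|x| = 1 -> x != 0.
Proof. by move=> x1; rewrite -normr_eq0 x1 oner_neq0. Qed.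

Lemma norm1_conjV (x : R[i]) : `|x| = 1 -> x^-1 = x^*%C.
Proof. by move=> x1; have /= := invC_norm x; rewrite x1 expr1n invr1 mul1r. Qed.

Lemma norm1_conjM (x : R[i]) : x * x^*%C = 1 -> `|x| = 1.
Proof.
move=> h; apply/eqP; rewrite -(eqrXn2 (n := 2)) ?expr1n //.
by have /= -> := normCK x; rewrite h.
Qed.

Lemma cayley_norm (z : R[i]) :
  z^*%C = - z -> 1 - z != 0 -> `|(1 + z) / (1 - z)| = 1.
Proof.
move=> zI z0; apply: norm1_conjM.
have conj1w : (1 + z)^*%C = 1 - z by rewrite rmorphD rmorph1 /= zI.
have conj1Nw : (1 - z)^*%C = 1 + z by rewrite rmorphB rmorph1 /= zI opprK.
have z0' : 1 + z != 0 by rewrite -conj1Nw conjc_eq0.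
by rewrite fmorph_div /= conj1w conj1Nw; field; rewrite z0 z0'.
Qed.

Variables (A s : R[i]).
Hypothesis s_sqr : s * s = 1.

Definition cayley D : R[i] := (D - 1) / (D + 1).

Lemma cayleyK D : D != - 1 -> D = (1 + cayley D) / (1 - cayley D).
Proof.
rewrite -subr_eq0 opprK => D1; rewrite /cayley.
have two0 : 2 != 0 :> R[i] by rewrite pnatr_eq0.
have -> : 1 - (D - 1) / (D + 1) = 2 / (D + 1) by field.
by field; rewrite D1.
Qed.

Lemma vertex_cayley b b1 D D1 : b != 0 -> D != - 1 -> D1 != - 1 ->
  vertex_eq A s b b1 D D1 -> cayley_eq A s b b1 (cayley D) (cayley D1).
Proof.
move=> b0; rewrite -subr_eq0 opprK => Dm; rewrite -subr_eq0 opprK => D1m.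
move/eqP; rewrite -subr_eq0 => /eqP h; apply/eqP; rewrite -subr_eq0; apply/eqP.
transitivity (2 / ((D + 1) * (D1 + 1)) *
  (b1 * (1 + D1) * (D - s) + A * (D - D1) - (1 + D) * (1 - s * D1) / b)).
  by rewrite /cayley; field; rewrite b0 Dm D1m.
by rewrite h mulr0.
Qed.

Lemma cayley_vertex b b1 z z1 : b != 0 -> 1 - z != 0 -> 1 - z1 != 0 ->
  cayley_eq A s b b1 z z1 ->
  vertex_eq A s b b1 ((1 + z) / (1 - z)) ((1 + z1) / (1 - z1)).
Proof.
move=> b0 z0 z10 /eqP; rewrite -subr_eq0 => /eqP h.
apply/eqP; rewrite -subr_eq0; apply/eqP.
transitivity (2 / ((1 - z) * (1 - z1)) *
  (b1 * ((1 - s) + (1 + s) * z) + A * (z - z1) - ((1 - s) - (1 + s) * z1) / b)).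
  by field; rewrite b0 z0 z10.
by rewrite h mulr0.
Qed.

Section Determination.
Hypothesis A_generic : forall b, `|b| = 1 -> A * b != 1 + s.

(** Along one edge the solution propagates in both directions.  The value
    [D = - 1], the point at infinity of the Cayley transform, is no exit: if one
    end has this value then [vertex_eq] is the product of [1 + D] or [1 + D1] at
    the other end and of a factor that [A_generic] keeps away from 0. *)
Lemma edge_step b b1 D D1 X x y beta beta1 z z1 :
  `|b| = 1 -> `|b1| = 1 -> D != 0 ->
  (forall lambda, lambda != 0 ->
    dressing b1 D1 lambda *m line_edge A s lambda =
    mx22 X ('i%C * (lambda - D * (s * D1) / lambda)) (x lambda) (y lambda)
      *m dressing b D lambda) ->
  angle_eq A s beta beta1 -> cayley_eq A s beta beta1 z z1 ->
  [/\ D != - 1, b = beta & cayley D = z] <->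
  [/\ D1 != - 1, b1 = beta1 & cayley D1 = z1].
Proof.
move=> ub ub1 D0 compat target_angle target_cayley.
have b0 := norm1_neq0 ub.
have [ha hb] := edge_eqs b0 D0 compat.
have gen_neq0 u : `|u| = 1 -> A - (1 + s) * u != 0.
  move=> u1; rewrite subr_eq0; apply: contra (A_generic (b := u^-1) _).
    by move=> /eqP ->; rewrite mulfK ?norm1_neq0.
  by rewrite normfV u1 invr1.
have D_neqN1 : (D != - 1) = (D1 != - 1).
  congr (~~ _); apply/eqP/eqP => DE; move: hb; rewrite /vertex_eq DE.
    move/eqP; rewrite subrr mul0r mul0r -subr_eq0 subr0.
    have -> : b1 * (1 + D1) * (- 1 - s) + A * (- 1 - D1)
       = - (1 + D1) * (A - (1 + s) * - b1) by ring.
    rewrite mulf_eq0 oppr_eq0 (negPf (gen_neq0 _ _)) ?normrN // orbF addr_eq0.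
    by move=> /eqP ->; rewrite opprK.
  move/eqP; rewrite subrr mulr0 mul0r add0r -subr_eq0.
  have -> : A * (D - - 1) - (1 + D) * (1 - s * - 1) / b
     = (1 + D) * (A - (1 + s) * b^-1) by ring.
  rewrite mulf_eq0 (negPf (gen_neq0 _ _)) ?normfV ?ub ?invr1 // orbF addr_eq0.
  by move=> /eqP ->; rewrite opprK.
suff main : D != - 1 -> D1 != - 1 ->
    (b = beta /\ cayley D = z) <-> (b1 = beta1 /\ cayley D1 = z1).
  split=> -[Dm bE zE].
    have D1m : D1 != - 1 by rewrite -D_neqN1.
    by have [? ?] := (main Dm D1m).1 (conj bE zE); split.
  have D0m : D != - 1 by rewrite D_neqN1.
  by have [? ?] := (main D0m Dm).2 (conj bE zE); split.
move=> Dm D1m.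
have {}ha : angle_eq A s b b1.
  apply/eqP; rewrite -subr_eq0; move/eqP: ha; rewrite mulf_eq0 => /orP[|//].
  by move=> D1E; case/negP: D1m; rewrite -addr_eq0 addrC.
have {}hb := vertex_cayley b0 Dm D1m hb.
split=> -[bE zE].
  subst b; rewrite zE in hb.
  have bE1 : b1 = beta1.
    by apply: (mulIf (gen_neq0 _ ub)); rewrite ha target_angle.
  split=> //; subst b1.
  have g := gen_neq0 beta^-1 _; rewrite normfV ub invr1 in g; have {}g := g erefl.
  move: hb target_cayley; rewrite /cayley_eq.
  move=> /eqP; rewrite -subr_eq0 => /eqP hb /eqP; rewrite -subr_eq0 => /eqP ht.
  apply: (mulIf g); apply/eqP; rewrite -subr_eq0; apply/eqP.
  by move: (etrans ht (esym hb)) => /eqP; rewrite -subr_eq0 => /eqP <-; ring.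
subst b1; rewrite zE in hb.
have g := gen_neq0 (- beta1) _; rewrite normrN ub1 in g; have {}g := g erefl.
have bE1 : b = beta.
  apply: (mulIf g).
  move: ha target_angle; rewrite /angle_eq.
  move=> /eqP; rewrite -subr_eq0 => /eqP ha /eqP; rewrite -subr_eq0 => /eqP ht.
  apply/eqP; rewrite -subr_eq0; apply/eqP.
  by move: (etrans ht (esym ha)) => /eqP; rewrite -subr_eq0 => /eqP <-; ring.
split=> //; subst b.
move: hb target_cayley; rewrite /cayley_eq.
move=> /eqP; rewrite -subr_eq0 => /eqP hb /eqP; rewrite -subr_eq0 => /eqP ht.
apply: (mulIf g); apply/eqP; rewrite -subr_eq0; apply/eqP.
by move: (etrans hb (esym ht)) => /eqP; rewrite -subr_eq0 => /eqP <-; ring.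
Qed.

End Determination.

Lemma angle_eq_rmorph (f : {rmorphism R[i] -> R[i]}) B u b b1 :
  angle_eq B u b b1 -> angle_eq (f B) (f u) (f b) (f b1).
Proof.
by move=> /(congr1 f); rewrite /angle_eq !(rmorphD, rmorphN, rmorphM, rmorph1).
Qed.

Lemma vertex_eq_rmorph (f : {rmorphism R[i] -> R[i]}) B u b b1 D D1 :
  vertex_eq B u b b1 D D1 ->
  vertex_eq (f B) (f u) (f b) (f b1) (f D) (f D1).
Proof.
move=> /(congr1 f); rewrite /vertex_eq.
by rewrite !(rmorphD, rmorphN, rmorphM, rmorph1, fmorphV).
Qed.

Lemma edge_entry_rmorph (f : {rmorphism R[i] -> R[i]}) B b b1 D D1 :
  f (edge_entry B b b1 D D1) = edge_entry (f B) (f b) (f b1) (f D) (f D1).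
Proof.
by rewrite /edge_entry !(rmorphD, rmorphN, rmorphM, rmorph1, fmorphV).
Qed.

Lemma det_mx22 (p q r t : R[i]) : \det (mx22 p q r t) = p * t - q * r.
Proof.
rewrite (expand_det_row _ 0) !big_ord_recl big_ord0 addr0 /cofactor !det_mx11 !mxE /=.
by rewrite /bump /= expr0 expr1 mul1r mulN1r mulrN.
Qed.

(** The edge function is the quotient of [edge_entry] by the factor of the
    edge function in the Lax matrix.  It is unitary because [edge_entry] and that
    factor have the same absolute value, which follows from multiplicativity
    of determinants at [lambda = 1].  The condition [`|c| != 1] excludes a zero
    denominator. *)
Lemma edge_exists (c b b1 z z1 : R[i]) : A = c + s * c^-1 -> c^*%C = c -> s^*%C = s ->
  c != 0 -> `|c| != 1 ->
  `|b| = 1 -> `|b1| = 1 -> z^*%C = - z -> z1^*%C = - z1 -> 1 - z != 0 -> 1 - z1 != 0 ->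
  angle_eq A s b b1 -> cayley_eq A s b b1 z z1 ->
  let D := (1 + z) / (1 - z) in let D1 := (1 + z1) / (1 - z1) in
  exists2 E : R[i], `|E| = 1 & forall lambda, lambda != 0 ->
    dressing b1 D1 lambda *m line_edge A s lambda =
    mx22 (c * (E / D) + c^-1 * (E * (s * D1)))
         ('i%C * (lambda - D * (s * D1) / lambda))
         ('i%C * (lambda - (lambda * D * (s * D1))^-1))
         (c * (D / E) + c^-1 * (E * (s * D1))^-1)
      *m dressing b D lambda.
Proof.
move=> AE c_real s_real c0 c1 ub ub1 zI z1I z0 z10 ha hz D D1.
have b0 := norm1_neq0 ub; have b10 := norm1_neq0 ub1.
have uD : `|D| = 1 by exact: cayley_norm.
have uD1 : `|D1| = 1 by exact: cayley_norm.
have D0 := norm1_neq0 uD; have D10 := norm1_neq0 uD1.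
have A_real : A^*%C = A by rewrite AE rmorphD rmorphM fmorphV /= c_real s_real.
have sV : s^-1 = s by case: (edge_sign s_sqr) => ->; rewrite ?invrN invr1.
have hv : vertex_eq A s b b1 D D1 by exact: cayley_vertex.
clearbody D D1.
have hvC : vertex_eq A s b^-1 b1^-1 D^-1 D1^-1.
  by have := vertex_eq_rmorph conjc hv; rewrite /= A_real s_real -!norm1_conjV.
have haC : angle_eq A s b^-1 b1^-1.
  by have := angle_eq_rmorph conjc ha; rewrite /= A_real s_real -!norm1_conjV.
pose X := edge_entry A b b1 D D1.
pose Y := edge_entry A b^-1 b1^-1 D^-1 D1^-1.
have XC : X^*%C = Y.
  have := edge_entry_rmorph conjc A b b1 D D1; rewrite /= A_real.
  by rewrite /Y (norm1_conjV ub) (norm1_conjV ub1) (norm1_conjV uD) (norm1_conjV uD1).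
have compat lambda : lambda != 0 ->
    dressing b1 D1 lambda *m line_edge A s lambda =
    mx22 X ('i%C * (lambda - D * (s * D1) / lambda))
         ('i%C * (lambda - (lambda * D * (s * D1))^-1)) Y *m dressing b D lambda.
  move=> l0; rewrite !mx22M.
  have [e00 e01] := edge_row s_sqr b0 D0 l0 ha hv.
  have [e11 e10] := edge_row s_sqr (invr_neq0 b0) (invr_neq0 D0) l0 haC hvC.
  have inv1 : (lambda * D1)^-1 = D1^-1 / lambda by rewrite invfM mulrC.
  have inv0 : (lambda * D)^-1 = D^-1 / lambda by rewrite invfM mulrC.
  have inv01 : (lambda * D * (s * D1))^-1 = D^-1 * (s * D1^-1) / lambda.
    by rewrite !invfM sV; ring.
  congr mx22; [exact: e00|exact: e01| |].
    move: e10; rewrite inv1 inv0 inv01 !invrK => e.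
    rewrite addrC [RHS]addrC [(1 + D1^-1) / b1]mulrC.
    by apply: etrans e _; congr (_ + _ * _); ring.
  move: e11; rewrite inv1 inv01 [(lambda * D^-1)^-1]invfM !invrK => e.
  rewrite addrC [RHS]addrC [(1 + D1^-1) / b1]mulrC.
  by apply: etrans e _; rewrite -/Y; ring.
have normXY : X * Y = (c / D + s * D1 / c) * (c * D + s / (c * D1)).
  have := congr1 determinant (compat 1 (oner_neq0 _)).
  rewrite !det_mulmx !det_mx22 !mul_i_i => /eqP; rewrite -subr_eq0 => /eqP e.
  have four0 : 4 != 0 :> R[i] by rewrite pnatr_eq0.
  apply: (mulfI four0); apply/eqP; rewrite eq_sym -subr_eq0 -e; apply/eqP.
  rewrite AE; case: (edge_sign s_sqr) => ->; field.
    by rewrite c0 D0 D10 b0 b10.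
  by rewrite c0 D0 D10 b0 b10.
pose K := c / D + s * D1 / c.
have KC : K^*%C = c * D + s / (c * D1).
  rewrite /K !(rmorphD, rmorphM, fmorphV) /= c_real s_real.
  rewrite -(norm1_conjV uD) -(norm1_conjV uD1) invrK.
  by rewrite invfM; ring.
have K0 : K != 0.
  apply: contraNneq c1 => /eqP; rewrite /K addr_eq0 => /eqP /(congr1 (fun x => `|x|)).
  rewrite normrN !normrM !normfV uD uD1 invr1 mulr1.
  have -> : `|s| = 1 by case: (edge_sign s_sqr) => ->; rewrite ?normrN normr1.
  rewrite mulr1 mul1r => e; rewrite -(eqrXn2 (n := 2)) // expr1n expr2 {2}e.
  by rewrite mulfV // normr_eq0.
have X0 : X != 0.
  have : X * Y != 0 by rewrite normXY -KC mulf_neq0 // conjc_eq0.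
  by rewrite mulf_eq0 negb_or => /andP[].
exists (X / K).
  apply: norm1_conjM; rewrite fmorph_div /= XC mulrACA normXY -KC -invfM.
  by rewrite -/K mulfV // mulf_neq0 // conjc_eq0.
move=> lambda l0; rewrite (compat _ l0); congr (mx22 _ _ _ _ *m _).
  transitivity (X / K * (c / D + s * D1 / c)); first by rewrite -/K divfK.
  by ring.
rewrite !invfM invrK sV.
transitivity (K^*%C * K / X).
  by rewrite KC [_ * K]mulrC -[K * _]normXY mulrAC mulfV // mul1r.
rewrite KC invfM; ring.
Qed.

End EdgeUnitary.

(** * The double transform of the straight line *)

Section KuenTransform.
Variables (R : realType) (delta1 delta2 : R).
Hypotheses (sin1_neq0 : sin delta1 != 0) (sin1_neq1 : sin delta1 != 1).
Hypotheses (sin1_neqN1 : sin delta1 != - 1).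
Hypotheses (sin2_neq0 : sin delta2 != 0) (cos2_neq0 : cos delta2 != 0).
Implicit Types (k n : int).

(** The values of [sb] and [sdb] up to the sign of the line: [kuen_angle] is the
    quotient of [1 + i g] by [1 - i g] for [g] the exponential of [- k tau], and
    [kuen_z] is the Cayley transform of the other one. *)
Definition kuen_angle k : R[i] :=
  tanh (k%:~R * tau delta1) +i* sech (k%:~R * tau delta1).
Definition kuen_y k n : R :=
  2 * n%:~R * tan delta2 * sech (k%:~R * tau delta1).
Definition kuen_z k n : R[i] := 0 +i* kuen_y k n.
Definition kuen_sb k n : R[i] := line_fun R k n * kuen_angle k.
Definition kuen_sdb k n : R[i] :=
  line_fun R k n * ((1 + kuen_z k n) / (1 - kuen_z k n)).

Lemma expR_neq0 (x : R) : expR x != 0.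
Proof. by rewrite gt_eqF // expR_gt0. Qed.

Lemma sqr_add1_neq0 (x : R) : x ^+ 2 + 1 != 0.
Proof. by rewrite gt_eqF // ltr_wpDl // sqr_ge0. Qed.

Lemma tanhE (x : R) : tanh x = (expR x ^+ 2 - 1) / (expR x ^+ 2 + 1).
Proof.
have e0 := expR_neq0 x; have e1 := sqr_add1_neq0 (expR x).
by rewrite /tanh /sinh /cosh expRN; field; rewrite e0 e1.
Qed.

Lemma sechE (x : R) : sech x = 2 * expR x / (expR x ^+ 2 + 1).
Proof.
have e0 := expR_neq0 x; have e1 := sqr_add1_neq0 (expR x).
by rewrite /sech /cosh expRN; field; rewrite e0 e1.
Qed.

Lemma tanh2Dsech2 (x : R) : tanh x ^+ 2 + sech x ^+ 2 = 1.
Proof. by rewrite tanhE sechE; field; rewrite sqr_add1_neq0. Qed.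

Lemma tanh_sech_norm (x : R) : `|tanh x +i* sech x : R[i]| = 1.
Proof.
apply: norm1_conjM; simpc; rewrite -!expr2 tanh2Dsech2.
by congr (_ +i* _)%C; ring.
Qed.

Lemma tanh_sechV (x : R) : (tanh x +i* sech x)^-1 = tanh x -i* sech x :> R[i].
Proof. by rewrite norm1_conjV // tanh_sech_norm. Qed.

Lemma kuen_angle_norm k : `|kuen_angle k| = 1.
Proof. exact: tanh_sech_norm. Qed.

Lemma sin1_lt1 : 0 < 1 - sin delta1 /\ 0 < 1 + sin delta1.
Proof.
have /andP[lo hi] : -1 <= sin delta1 <= 1 by rewrite sin_geN1 sin_le1.
split; first by rewrite subr_gt0 lt_neqAle sin1_neq1.
by rewrite -ltrBlDl sub0r lt_neqAle eq_sym sin1_neqN1.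
Qed.

Lemma expR_tau_step k : expR ((k + 1)%:~R * tau delta1) =
  expR (k%:~R * tau delta1) * ((1 - sin delta1) / (1 + sin delta1)).
Proof.
have [s1 s2] := sin1_lt1.
by rewrite intrD mulrDl mul1r expRD /tau lnK // posrE divr_gt0.
Qed.

(** The parameter [tau] is chosen such that the Moebius map of a horizontal edge
    multiplies [expR (k tau)] by [(1 - sin delta1) / (1 + sin delta1)]. *)
Lemma kuen_horizontal k n :
  let A := (2 / sin delta1)%:C in
  angle_eq A 1 (kuen_angle k) (kuen_angle (k + 1)) /\
  cayley_eq A 1 (kuen_angle k) (kuen_angle (k + 1)) (kuen_z k n) (kuen_z (k + 1) n).
Proof.
have [/gt_eqF s1 /gt_eqF s2] := sin1_lt1.
have e1 := sqr_add1_neq0 (expR (k%:~R * tau delta1)).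
have e3 : (expR (k%:~R * tau delta1) * (1 - sin delta1)) ^+ 2
    + (1 + sin delta1) ^+ 2 != 0.
  by rewrite gt_eqF // ltr_wpDl ?sqr_ge0 // exprn_gt0 //; have [] := sin1_lt1.
rewrite /angle_eq /cayley_eq /kuen_angle tanh_sechV /kuen_z /kuen_y !tanhE !sechE.
rewrite expR_tau_step.
move: (expR _) (sin delta1) (tan delta2) e1 e3 s1 s2 (sin1_neq0) =>
  e S T e1 e3 s1 s2 s0.
by split; apply/eqP; rewrite eq_complex; apply/andP; split; apply/eqP => /=;
  field; rewrite e1 s0 s2 e3.
Qed.

(** Vertical edges do not change the angle, and shift [z] by the difference of
    the angle and its conjugate times [tan delta2]. *)
Lemma kuen_vertical k n :
  let A := (2 * cos delta2 / sin delta2)%:C in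
  angle_eq A (- 1) (kuen_angle k) (kuen_angle k) /\
  cayley_eq A (- 1) (kuen_angle k) (kuen_angle k) (kuen_z k n) (kuen_z k (n + 1)).
Proof.
rewrite /angle_eq /cayley_eq; split; first by ring.
rewrite /kuen_angle tanh_sechV /kuen_z /kuen_y intrD /tan.
by apply/eqP; rewrite eq_complex; apply/andP; split; apply/eqP => /=;
  field; rewrite sin2_neq0 cos2_neq0.
Qed.

Lemma horizontal_generic b : `|b| = 1 -> (2 / sin delta1)%:C * b != 1 + 1 :> R[i].
Proof.
have [s1 s2] := sin1_lt1.
move=> b1; apply: contraTneq isT => /(congr1 (fun x => `|x|)).
rewrite normrM b1 mulr1 -[1 + 1]/(2%:R) normr_nat => /eqP.
rewrite normc_def /= expr0n /= addr0 sqrtr_sqr eq_complex /= => /andP[/eqP].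
rewrite normrM normfV normr_nat => e _.
have : `|sin delta1| = 1.
  have S0 : `|sin delta1| != 0 by rewrite normr_eq0.
  apply: (mulfI (x := 2)); first by rewrite pnatr_eq0.
  by rewrite mulr1 -[RHS](divfK S0) e.
by case: ger0P => _ se; [rewrite se subrr ltxx in s1|rewrite -se addNr ltxx in s2].
Qed.

Lemma vertical_generic b : `|b| = 1 ->
  (2 * cos delta2 / sin delta2)%:C * b != 1 + - 1 :> R[i].
Proof.
move=> b1; rewrite subrr; apply: mulf_neq0; last exact: norm1_neq0.
by rewrite eq_complex /= eqxx andbT !mulf_neq0 ?invr_neq0 //.
Qed.

(** A Lax matrix depends only on the quotients and products of its three values,
    so a common sign [eps] can be moved into them; [sgn] accounts for the change
    of sign of the line along the edge. *)
Lemma lax_edge delta (c e s s' lambda eps sgn : R[i]) :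
  c = (cot (delta / 2))%:C -> c^-1 = (tan (delta / 2))%:C ->
  eps * eps = 1 -> sgn * sgn = 1 ->
  let E := eps * e in let D := eps * s in let D1 := sgn * (eps * s') in
  lax delta e s s' lambda =
  mx22 (c * (E / D) + c^-1 * (E * (sgn * D1)))
       ('i%C * (lambda - D * (sgn * D1) / lambda))
       ('i%C * (lambda - (lambda * D * (sgn * D1))^-1))
       (c * (D / E) + c^-1 * (E * (sgn * D1))^-1).
Proof.
move=> cE cVE eps2 sgn2 E D D1.
have eps0 : eps != 0 by apply: contra_eq_neq eps2 => ->; rewrite mul0r eq_sym oner_eq0.
have sD1 : sgn * D1 = eps * s' by rewrite mulrA sgn2 mul1r.
have epsM x y : (eps * x) * (eps * y) = x * y by rewrite mulrACA eps2 mul1r.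
have epsV x y : (eps * x) / (eps * y) = x / y.
  by rewrite invfM mulrACA divff // mul1r.
rewrite sD1 /E /D !epsV -[lambda * (eps * s) * _]mulrA !epsM [lambda * (s * s')]mulrA.
by rewrite /lax -cE -cVE.
Qed.

Lemma kuenB_dressing (sb sdb : int -> int -> R[i]) k n lambda :
  kuenB sb sdb k n lambda =
  dressing (line_fun R k n * sb k n) (line_fun R k n * sdb k n) lambda.
Proof.
have e2 := line_fun_sqr R k n; have eV := line_funV R k n.
rewrite /kuenB /backlundB /dressing !invfM eV; congr mx22.
- by rewrite mulrDr mulrDr mulr1 mulrACA e2; ring.
- by congr (_ * (_ - _ / _)); ring.
- by congr (_ * (_ - _)); ring.
- set e := line_fun R k n in e2 *.
  transitivity ((sb k n)^-1 * (e * e * (sdb k n)^-1 + e)); last by ring.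
  by rewrite e2 mul1r.
Qed.

Lemma line_fun_norm k n : `|line_fun R k n| = 1.
Proof.
by apply/eqP; rewrite -(eqrXn2 (n := 2)) // expr1n -normrX expr2 line_fun_sqr normr1.
Qed.

Lemma laxL_line_edge k n lambda :
  laxL delta1 (@line_fun R) (@line_fun R) k n lambda =
  line_edge (2 / sin delta1)%:C 1 lambda.
Proof. by rewrite laxL_line // /line_edge mul1r. Qed.

Lemma laxM_line_edge k n lambda :
  laxM delta2 (@line_fun R) (@line_fun R) k n lambda =
  line_edge (2 * cos delta2 / sin delta2)%:C (- 1) lambda.
Proof. by rewrite laxM_line // /line_edge mulN1r opprK. Qed.

Lemma laxL_edge (s l : int -> int -> R[i]) k n lambda :
  let eps := line_fun R k n in
  let c : R[i] := (cot (delta1 / 2))%:C in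
  let E := eps * l k n in let D := eps * s k n in
  let D1 := line_fun R (k + 1) n * s (k + 1) n in
  laxL delta1 s l k n lambda =
  mx22 (c * (E / D) + c^-1 * (E * (1 * D1)))
       ('i%C * (lambda - D * (1 * D1) / lambda))
       ('i%C * (lambda - (lambda * D * (1 * D1))^-1))
       (c * (D / E) + c^-1 * (E * (1 * D1))^-1).
Proof.
move=> eps c E D D1.
have -> : D1 = 1 * (eps * s (k + 1) n) by rewrite mul1r.
apply: lax_edge => //; rewrite ?mulr1 ?line_fun_sqr //.
by rewrite tan_half // fmorphV.
Qed.

Lemma laxM_edge (s m : int -> int -> R[i]) k n lambda :
  let eps := line_fun R k n in
  let c : R[i] := (cot (delta2 / 2))%:C in
  let E := eps * m k n in let D := eps * s k n in
  let D1 := line_fun R k (n + 1) * s k (n + 1) in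
  laxM delta2 s m k n lambda =
  mx22 (c * (E / D) + c^-1 * (E * (- 1 * D1)))
       ('i%C * (lambda - D * (- 1 * D1) / lambda))
       ('i%C * (lambda - (lambda * D * (- 1 * D1))^-1))
       (c * (D / E) + c^-1 * (E * (- 1 * D1))^-1).
Proof.
move=> eps c E D D1.
have -> : D1 = - 1 * (eps * s k (n + 1)).
  by rewrite /D1 line_funS mulN1r mulNr.
apply: lax_edge => //; rewrite ?mulrNN ?mulr1 ?line_fun_sqr //.
by rewrite tan_half // fmorphV.
Qed.

Lemma kuen_transform_unique (sb sdb : int -> int -> R[i]) :
  kuen_transform delta1 delta2 sb sdb ->
  forall k n, sb k n = kuen_sb k n /\ sdb k n = kuen_sdb k n.
Proof.
move=> [usb usdb sb0 sdb0 [l [m [_ _ compat]]]].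
pose beta k n := line_fun R k n * sb k n.
pose D k n := line_fun R k n * sdb k n.
have ubeta k n : `|beta k n| = 1 by rewrite normrM line_fun_norm usb mulr1.
have D0 k n : D k n != 0 by apply: norm1_neq0; rewrite normrM line_fun_norm usdb mulr1.
(* The first condition makes the Cayley transform in the third one faithful. *)
pose good k n := [/\ D k n != - 1, beta k n = kuen_angle k & cayley (D k n) = kuen_z k n].
have step1 k n : good k n <-> good (k + 1) n.
  have [ha hz] := kuen_horizontal k n.
  have compat1 lambda (l0 : lambda != 0) := (compat k n lambda l0).1.
  have := edge_step horizontal_generic (ubeta k n) (ubeta (k + 1) n) (D0 k n) _ ha hz.
  apply=> lambda l0; have := compat1 lambda l0.
  by rewrite !kuenB_dressing laxL_line_edge laxL_edge => ->.
have step2 k n : good k n <-> good k (n + 1).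
  have [ha hz] := kuen_vertical k n.
  have compat2 lambda (l0 : lambda != 0) := (compat k n lambda l0).2.
  have := edge_step vertical_generic (ubeta k n) (ubeta k (n + 1)) (D0 k n) _ ha hz.
  apply=> lambda l0; have := compat2 lambda l0.
  by rewrite !kuenB_dressing laxM_line_edge laxM_edge => ->.
have two0 : 2 != 0 :> R[i] by rewrite pnatr_eq0.
have good00 : good 0 0.
  rewrite /good /D /beta /line_fun expr0z sb0 sdb0 !mul1r; split.
  - by rewrite -subr_eq0 opprK.
  - rewrite /kuen_angle mul0r tanhE sechE expR0 expr1n subrr mul0r mulr1.
    by congr (_ +i* _)%C; rewrite divff // pnatr_eq0.
  - by rewrite /cayley subrr mul0r /kuen_z /kuen_y mulr0 !mul0r.
have goodE k n : good k n.
  elim/int_shift_ind: n => [|n]; last exact: step2.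
  by elim/int_shift_ind: k => [//|k]; exact: step1.
move=> k n; have [Dm bE zE] := goodE k n.
have line_sol x y : line_fun R k n * x = y -> x = line_fun R k n * y.
  by move=> <-; rewrite mulrA line_fun_sqr mul1r.
split; first exact: line_sol.
by apply: line_sol; rewrite -zE -cayleyK.
Qed.

Lemma kuen_z_sub_neq0 k n : 1 - kuen_z k n != 0.
Proof. by rewrite eq_complex /= subr0 oner_eq0. Qed.

Lemma kuen_z_conj k n : (kuen_z k n)^*%C = - kuen_z k n.
Proof. by rewrite /kuen_z; simpc. Qed.

Lemma kuen_sdb_norm k n : `|kuen_sdb k n| = 1.
Proof.
rewrite normrM line_fun_norm mul1r; apply: cayley_norm.
  exact: kuen_z_conj.
exact: kuen_z_sub_neq0.
Qed.

(** A number of absolute value 1 equals its inverse, but [cot (delta / 2)] and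
    [tan (delta / 2)] differ by a nonzero multiple of [cos delta]. *)
Lemma cot_half_norm delta : sin delta != 0 -> cos delta != 0 ->
  `|(cot (delta / 2))%:C : R[i]| != 1.
Proof.
move=> s0 c0; rewrite normc_def /= expr0n /= addr0 sqrtr_sqr.
rewrite eq_complex /= eqxx andbT; apply: contra c0 => /eqP h.
have h2 : cot (delta / 2) ^+ 2 = 1 by rewrite -(real_normK (num_real _)) h expr1n.
have ct0 := cot_half_neq0 s0.
have := cot_sub_tan_half s0; rewrite tan_half // => e.
have : 2 * cos delta / sin delta = 0.
  rewrite -e; apply: (mulIf ct0); rewrite mulrBl mulVf // -expr2 h2; ring.
move=> /eqP; rewrite !mulf_eq0 invr_eq0 (negPf s0) orbF pnatr_eq0 /=.
by [].
Qed.

Lemma kuen_transform_exists : kuen_transform delta1 delta2 kuen_sb kuen_sdb.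
Proof.
have lineK k n x : line_fun R k n * (line_fun R k n * x) = x.
  by rewrite mulrA line_fun_sqr mul1r.
have cot_neq0 delta : sin delta != 0 -> (cot (delta / 2))%:C != 0 :> R[i].
  by move=> s0; rewrite eq_complex /= eqxx andbT cot_half_neq0.
have AE delta : sin delta != 0 ->
    (tan (delta / 2))%:C = ((cot (delta / 2))%:C)^-1 :> R[i].
  by move=> s0; rewrite tan_half // fmorphV.
have A1 : (2 / sin delta1)%:C
    = (cot (delta1 / 2))%:C + 1 * ((cot (delta1 / 2))%:C)^-1 :> R[i].
  by rewrite -cot_add_tan_half // rmorphD /= AE // mul1r.
have A2 : (2 * cos delta2 / sin delta2)%:C
    = (cot (delta2 / 2))%:C + - 1 * ((cot (delta2 / 2))%:C)^-1 :> R[i].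
  by rewrite -cot_sub_tan_half // rmorphB /= AE // mulN1r.
have cos1_neq0 : cos delta1 != 0.
  rewrite -sqrf_eq0 cos2sin2 subr_eq0 eq_sym sqrf_eq1 negb_or.
  by rewrite sin1_neq1 sin1_neqN1.
have sqrN1 : - 1 * - 1 = 1 :> R[i] by rewrite mulrNN mulr1.
have conj_real (x : R) : (x%:C)^*%C = x%:C by simpc.
have conj_sign : (- 1 : R[i])^*%C = - 1 by rewrite rmorphN rmorph1.
have edge1 (p : int * int) : exists E : R[i], `|E| = 1 /\ forall lambda, lambda != 0 ->
    kuenB kuen_sb kuen_sdb (p.1 + 1) p.2 lambda
      *m laxL delta1 (@line_fun R) (@line_fun R) p.1 p.2 lambda
    = laxL delta1 kuen_sdb (fun k n => line_fun R k n * E) p.1 p.2 lambda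
      *m kuenB kuen_sb kuen_sdb p.1 p.2 lambda.
  case: p => k n /=; have [ha hz] := kuen_horizontal k n.
  have [E E1 compat] := edge_exists (mulr1 1) A1 (conj_real _) (conj_real 1)
    (cot_neq0 _ sin1_neq0) (cot_half_norm sin1_neq0 cos1_neq0)
    (kuen_angle_norm k) (kuen_angle_norm (k + 1)) (kuen_z_conj k n)
    (kuen_z_conj (k + 1) n) (kuen_z_sub_neq0 k n) (kuen_z_sub_neq0 (k + 1) n) ha hz.
  exists E; split=> // lambda l0.
  by rewrite !kuenB_dressing laxL_line_edge laxL_edge !lineK; exact: compat.
have edge2 (p : int * int) : exists E : R[i], `|E| = 1 /\ forall lambda, lambda != 0 ->
    kuenB kuen_sb kuen_sdb p.1 (p.2 + 1) lambda
      *m laxM delta2 (@line_fun R) (@line_fun R) p.1 p.2 lambda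
    = laxM delta2 kuen_sdb (fun k n => line_fun R k n * E) p.1 p.2 lambda
      *m kuenB kuen_sb kuen_sdb p.1 p.2 lambda.
  case: p => k n /=; have [ha hz] := kuen_vertical k n.
  have [E E1 compat] := edge_exists sqrN1 A2 (conj_real _) conj_sign
    (cot_neq0 _ sin2_neq0) (cot_half_norm sin2_neq0 cos2_neq0)
    (kuen_angle_norm k) (kuen_angle_norm k) (kuen_z_conj k n)
    (kuen_z_conj k (n + 1)) (kuen_z_sub_neq0 k n) (kuen_z_sub_neq0 k (n + 1)) ha hz.
  exists E; split=> // lambda l0.
  by rewrite !kuenB_dressing laxM_line_edge laxM_edge !lineK; exact: compat.
have [El HEl] := choice edge1; have [Em HEm] := choice edge2.
split.
- by move=> k n; rewrite normrM line_fun_norm kuen_angle_norm mulr1.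
- exact: kuen_sdb_norm.
- rewrite /kuen_sb /line_fun expr0z mul1r /kuen_angle mul0r tanhE sechE expR0 expr1n.
  rewrite subrr mul0r mulr1.
  by congr (_ +i* _)%C; rewrite divff // pnatr_eq0.
- rewrite /kuen_sdb /line_fun expr0z mul1r /kuen_z /kuen_y mulr0 !mul0r.
  by rewrite addr0 subr0 divff // oner_neq0.
exists (fun k n => line_fun R k n * El (k, n)), (fun k n => line_fun R k n * Em (k, n)).
split.
- by move=> k n; rewrite normrM line_fun_norm (HEl _).1 mulr1.
- by move=> k n; rewrite normrM line_fun_norm (HEm _).1 mulr1.
move=> k n lambda l0; split.
  exact: (HEl (k, n)).2.
exact: (HEm (k, n)).2.
Qed.

End KuenTransform.

(** * The net and the Gauss map *)

Section Surface.
Variable R : realType.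
Implicit Types (x y t : R).

(** Multiplying the first row of the dressing matrix by [1 - i y] and the second
    one by [1 + i y] clears all denominators and leaves this quaternion; the
    diagonal matrix that undoes it is [dressing_phase]. *)
Definition dressing_core x y t : 'M[R[i]]_2 :=
  quat (2 * tanh x) (- 2 * sinh t) (- 2 * y * cosh t) (- 2 * sech x).

Definition dressing_phase y : 'M[R[i]]_2 :=
  quat (1 + y ^+ 2)^-1 0 0 (- y / (1 + y ^+ 2)).

Lemma one_add_sqr_neq0 y : 1 + y ^+ 2 != 0.
Proof. by rewrite gt_eqF // ltr_pwDl // sqr_ge0. Qed.

Lemma sech_neq0 x : sech x != 0.
Proof. by rewrite invr_neq0 // gt_eqF // cosh_gt0. Qed.

Lemma dressing_quat x y t :
  dressing (tanh x +i* sech x) ((1 + (0 +i* y)) / (1 - (0 +i* y))) (spectral t) =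
  dressing_phase y *m dressing_core x y t.
Proof.
have y0 := one_add_sqr_neq0 y; have l0 := expR_neq0 t.
have z0 : 1 - (0 +i* y) != 0 :> R[i] by rewrite eq_complex /= subr0 oner_eq0.
have DE : (1 + (0 +i* y)) / (1 - (0 +i* y))
    = ((1 - y ^+ 2) / (1 + y ^+ 2)) +i* (2 * y / (1 + y ^+ 2)) :> R[i].
  apply: (mulIf z0); rewrite (divfK z0).
  by apply/eqP; rewrite eq_complex; apply/andP; split; apply/eqP => /=; field.
have DVE : ((1 + (0 +i* y)) / (1 - (0 +i* y)))^-1
    = ((1 - y ^+ 2) / (1 + y ^+ 2)) -i* (2 * y / (1 + y ^+ 2)) :> R[i].
  rewrite norm1_conjV; first by rewrite DE.
  by apply: cayley_norm => //; simpc.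
have bV := tanh_sechV x.
rewrite /dressing /dressing_phase /dressing_core quatM invfM DVE DE bV.
rewrite /spectral -fmorphV /cosh /sinh expRN /quat.
move: (expR t) l0 (tanh x) (sech x) => l l0 tx sx.
by congr mx22; apply/eqP; rewrite eq_complex; apply/andP; split; apply/eqP => /=;
  field; rewrite ?l0 ?y0.
Qed.

(** The scalar part is half the logarithmic derivative of the determinant of
    [dressing_core], which is a multiple of the square of [cosh t]; the vector
    part is half the displacement from the straight line, before the rotation by
    [omega]. *)
Definition core_log_deriv x y t : 'M[R[i]]_2 :=
  let r := sech t / (1 + y ^+ 2) in
  quat (tanh t) (r * (sech x * y * tanh t - tanh x))
       (- r * (y * tanh t * tanh x + sech x)) (r * y * sech t).

(** The third axis rotated by the quaternion [dressing_core]. *)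
Definition core_normal x y t : 'M[R[i]]_2 :=
  let r := sech t ^+ 2 / (1 + y ^+ 2) in
  quat 0 (r * (2 * (y * cosh t * tanh x + sinh t * sech x)))
       (r * (2 * y * cosh t * sech x - 2 * sinh t * tanh x))
       (r * (1 - sinh t ^+ 2 - y ^+ 2 * cosh t ^+ 2)).

Lemma dressing_core_derive x y t :
  is_mxderive (dressing_core x y) t (dressing_core x y t *m core_log_deriv x y t).
Proof.
have y0 := one_add_sqr_neq0 y; have e0 := sqr_add1_neq0 (expR x).
have l0 := expR_neq0 t; have l1 := sqr_add1_neq0 (expR t).
have -> : dressing_core x y t *m core_log_deriv x y t =
    quat 0 (- 2 * cosh t) (- 2 * y * sinh t) 0.
  rewrite quatM !tanhE !sechE /cosh /sinh !expRN.
  by congr quat; field; rewrite ?y0 ?e0 ?l0 ?l1.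
apply: is_mxderive_quat; try exact: is_derive_cst.
  exact: (is_derive_eq (is_deriveZ (- 2) (is_derive_sinh t))).
exact: (is_derive_eq (is_deriveZ (- 2 * y) (is_derive_cosh t))).
Qed.

Lemma dressing_core_normal x y t :
  quat 0 0 0 1 *m dressing_core x y t = dressing_core x y t *m core_normal x y t.
Proof.
have y0 := one_add_sqr_neq0 y; have e0 := sqr_add1_neq0 (expR x).
have l0 := expR_neq0 t; have l1 := sqr_add1_neq0 (expR t).
rewrite !quatM !tanhE !sechE /cosh /sinh !expRN.
by congr quat; field; rewrite ?y0 ?e0 ?l0 ?l1.
Qed.

Lemma dressing_core_unitmx x y t : dressing_core x y t \in unitmx.
Proof.
apply: quat_unitmx; rewrite gt_eqF //.
have sx : 0 < (- 2 * sech x) ^+ 2.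
  by rewrite lt_def sqr_ge0 andbT sqrf_eq0 mulf_neq0 ?sech_neq0 // oppr_eq0 pnatr_eq0.
by rewrite ltr_wpDl // !addr_ge0 ?sqr_ge0.
Qed.

Lemma dressing_phase_unitmx y : dressing_phase y \in unitmx.
Proof.
apply: quat_unitmx; rewrite gt_eqF //.
have : 0 < ((1 + y ^+ 2)^-1) ^+ 2.
  by rewrite lt_def sqr_ge0 andbT sqrf_eq0 invr_neq0 // one_add_sqr_neq0.
by move=> p; rewrite -!addrA ltr_pwDl // !addr_ge0 ?sqr_ge0.
Qed.

Lemma dressing_phase_sigma3 y :
  quat 0 0 0 1 *m dressing_phase y = dressing_phase y *m quat 0 0 0 1.
Proof. by rewrite !quatM; congr quat; ring. Qed.

End Surface.

Section Kuen.
Variables (R : realType) (delta1 delta2 : R).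
Hypotheses (sin1_neq0 : sin delta1 != 0) (sin1_neq1 : sin delta1 != 1).
Hypotheses (sin1_neqN1 : sin delta1 != - 1).
Hypotheses (sin2_neq0 : sin delta2 != 0) (cos2_neq0 : cos delta2 != 0).

Lemma gauss_map_eq (Phi : frame_family R) k n t N : Phi k n t \in unitmx ->
  quat 0 0 0 1 *m Phi k n t = Phi k n t *m N -> gauss_map Phi k n t = N.
Proof.
move=> Phi_unit PhiN; have sigma3E : - 'i%C *: sigma3 R = quat 0 0 0 1.
  by rewrite /sigma3 mx22_scale; congr mx22; simpc; rewrite ?oppr0.
by rewrite /gauss_map scalemxAl scalemxAr sigma3E -mulmxA PhiN mulKmx.
Qed.

Lemma net_eq (Phi : frame_family R) k n t a b c d : Phi k n t \in unitmx ->
  is_mxderive (Phi k n) t (Phi k n t *m quat a b c d) ->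
  net Phi k n t = quat 0 (2 * b) (2 * c) (2 * d).
Proof.
move=> Phi_unit dPhi; rewrite /net (derivemx_eq dPhi) mulKmx // tracefree_quat.
have -> : 2%:R = (2 : R)%:C :> R[i] by rewrite rmorph_nat.
by rewrite quatZ mulr0.
Qed.

(** Existence and uniqueness of the transform together: the frames of Kuen's
    surface are all equal to this product. *)
Lemma kuen_frameP (Phi : frame_family R) :
  is_kuen_frame delta1 delta2 Phi <->
  forall k n t, Phi k n t = dressing_phase (kuen_y delta1 delta2 k n)
    *m dressing_core (k%:~R * tau delta1) (kuen_y delta1 delta2 k n) t
    *m quat_of_C (line_exp delta1 delta2 k n t).
Proof.
have B_eq k n t : kuenB (kuen_sb delta1) (kuen_sdb delta1 delta2) k n (spectral t)
   = dressing_phase (kuen_y delta1 delta2 k n)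
     *m dressing_core (k%:~R * tau delta1) (kuen_y delta1 delta2 k n) t.
  rewrite kuenB_dressing -dressing_quat !(mulrA (line_fun _ _ _)) line_fun_sqr !mul1r.
  by [].
split.
  move=> [sb [sdb [Phi0 [trans frame Phi00 PhiE]]]] k n t.
  have Phi0E := (line_frameP sin1_neq0 sin2_neq0 cos2_neq0 Phi0).1 (conj frame Phi00).
  rewrite PhiE Phi0E -B_eq /kuenB.
  by have [-> ->] := kuen_transform_unique sin1_neq0 sin1_neq1 sin1_neqN1
    sin2_neq0 cos2_neq0 trans k n.
move=> PhiE.
pose Phi0 : frame_family R := fun k n t => quat_of_C (line_exp delta1 delta2 k n t).
have [frame Phi00] :=
  (line_frameP sin1_neq0 sin2_neq0 cos2_neq0 Phi0).2 (fun k n t => erefl).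
exists (kuen_sb delta1), (kuen_sdb delta1 delta2), Phi0; split=> //.
  exact: kuen_transform_exists.
by move=> k n t; rewrite PhiE B_eq.
Qed.

Lemma vec3_addZ (a1 a2 a3 r b1 b2 b3 : R) :
  vec3 a1 a2 a3 + r *: vec3 b1 b2 b3 =
  vec3 (a1 + r * b1) (a2 + r * b2) (a3 + r * b3).
Proof. by apply/colP => -[[|[|[|//]]] hj]; rewrite !mxE. Qed.

Lemma vec3_scale (r b1 b2 b3 : R) :
  r *: vec3 b1 b2 b3 = vec3 (r * b1) (r * b2) (r * b3).
Proof. by apply/colP => -[[|[|[|//]]] hj]; rewrite !mxE. Qed.

Lemma sinh_double (x : R) : sinh (2 * x) = 2 * sinh x * cosh x.
Proof.
have e0 := expR_neq0 x.
by rewrite /sinh /cosh expRN mulr_natl mulr2n expRD expRN; field.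
Qed.

(** [x] is the argument of the hyperbolic functions, [y] the coordinate of
    [sdb], and [u] the complex number of the frame of the straight line. *)
Section Frame.
Variable Phi : frame_family R.
Hypothesis Phi_frame : is_kuen_frame delta1 delta2 Phi.
Variables (k n : int) (t : R).
Let x := k%:~R * tau delta1.
Let y := kuen_y delta1 delta2 k n.
Let u := line_exp delta1 delta2 k n.
Let w := omega delta1 delta2 k n t.

Lemma kuen_frame_eq v :
  Phi k n v = dressing_phase y *m dressing_core x y v *m quat_of_C (u v).
Proof. exact: (kuen_frameP Phi).1. Qed.

Lemma line_exp_conj : (u t)^*%C / u t = w.
Proof. exact: line_exp_omega. Qed.

Lemma u_neq0 : u t != 0.
Proof. exact: line_exp_neq0. Qed.

Lemma kuen_frame_unitmx : Phi k n t \in unitmx.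
Proof.
rewrite kuen_frame_eq !unitmx_mul dressing_phase_unitmx dressing_core_unitmx /=.
by case/mulmx1_unit: (quat_of_CVr u_neq0).
Qed.

Lemma cosh_neq0 (v : R) : cosh v != 0.
Proof. by rewrite gt_eqF ?cosh_gt0. Qed.

Lemma kuen_denominator_neq0 :
  cosh x ^+ 2 + 4 * n%:~R ^+ 2 * tan delta2 ^+ 2 != 0.
Proof.
rewrite gt_eqF // ltr_pwDl ?exprn_gt0 ?cosh_gt0 //.
have -> : 4 * n%:~R ^+ 2 * tan delta2 ^+ 2 = (2 * n%:~R * tan delta2) ^+ 2 by ring.
exact: sqr_ge0.
Qed.

Lemma kuen_net : net Phi k n t = quat_of_vec (f_kuen delta1 delta2 k n t).
Proof.
(* The first summand is [core_log_deriv] rotated by the frame of the line. *)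
have dPhi : is_mxderive (Phi k n) t (Phi k n t *m
    (quat (tanh t) (sech t / (1 + y ^+ 2) * (sech x * y * tanh t - tanh x))
     (- (sech t / (1 + y ^+ 2)) * (y * tanh t * tanh x + sech x) * complex.Re w
      + sech t / (1 + y ^+ 2) * y * sech t * complex.Im w)
     (sech t / (1 + y ^+ 2) * y * sech t * complex.Re w
      - - (sech t / (1 + y ^+ 2)) * (y * tanh t * tanh x + sech x) * complex.Im w)
     + quat_of_C (line_log_deriv delta1 delta2 k n t))).
  have -> : Phi k n = fun v => dressing_phase y *m dressing_core x y v *m quat_of_C (u v).
    by apply/funext => v; exact: kuen_frame_eq.
  have dJ := is_mxderive_quat_of_C
    (is_Cderive_line_exp sin1_neq0 sin2_neq0 cos2_neq0 k n t).
  have dH := is_mxderiveM (is_mxderive_cst (dressing_phase y) t)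
    (dressing_core_derive x y t).
  have := is_mxderiveM dH dJ; congr is_mxderive.
  rewrite mul0mx add0r quat_of_CM mulmxDr -/u !mulmxA; congr (_ + _).
  rewrite -!mulmxA; congr (_ *m (_ *m _)).
  rewrite /core_log_deriv (quat_of_C_rotate _ _ _ _ u_neq0) line_exp_conj.
  reflexivity.
move: dPhi; rewrite /quat_of_C quatD => /(net_eq kuen_frame_unitmx) ->.
rewrite Im_line_log_deriv //.
rewrite /f_kuen /f_line vec3_addZ quat_of_vecE -/w -/x /y /kuen_y -/x /tanh /sech.
have x0 := cosh_neq0 x; have t0 := cosh_neq0 t.
have D0 := kuen_denominator_neq0.
by congr quat; field; rewrite x0 t0 D0.
Qed.

Lemma kuen_gauss_map :
  gauss_map Phi k n t = quat_of_vec (n_kuen delta1 delta2 k n t).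
Proof.
(* [core_normal] rotated by the frame of the line *)
rewrite (gauss_map_eq (N := quat 0
  (sech t ^+ 2 / (1 + y ^+ 2) * (2 * (y * cosh t * tanh x + sinh t * sech x)))
  (sech t ^+ 2 / (1 + y ^+ 2) * (2 * y * cosh t * sech x - 2 * sinh t * tanh x) * complex.Re w
   + sech t ^+ 2 / (1 + y ^+ 2) * (1 - sinh t ^+ 2 - y ^+ 2 * cosh t ^+ 2) * complex.Im w)
  (sech t ^+ 2 / (1 + y ^+ 2) * (1 - sinh t ^+ 2 - y ^+ 2 * cosh t ^+ 2) * complex.Re w
   - sech t ^+ 2 / (1 + y ^+ 2) * (2 * y * cosh t * sech x - 2 * sinh t * tanh x) * complex.Im w))
  kuen_frame_unitmx); last first.
  rewrite kuen_frame_eq !mulmxA dressing_phase_sigma3.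
  rewrite -(mulmxA (dressing_phase y)) dressing_core_normal -!mulmxA.
  rewrite /core_normal (quat_of_C_rotate _ _ _ _ u_neq0) line_exp_conj.
  reflexivity.
rewrite /n_kuen vec3_scale quat_of_vecE /kuen_D /kuen_E -/w -/x sinh_double.
rewrite /y /kuen_y -/x /tanh /sech.
have x0 := cosh_neq0 x; have t0 := cosh_neq0 t.
have D0 := kuen_denominator_neq0.
by congr quat; field; rewrite x0 t0 D0.
Qed.

End Frame.

End Kuen.

Local Close Scope complex_scope.

Theorem theorem2p17 (R : realType) (delta1 delta2 : R)
    (sin1_neq0 : sin delta1 != 0) (sin1_neq1 : sin delta1 != 1)
    (sin1_neqN1 : sin delta1 != - 1)
    (sincos2_neq0 : sin delta2 * cos delta2 != 0) :
  (exists Phi : frame_family R, is_kuen_frame delta1 delta2 Phi) /\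
  (forall Phi : frame_family R, is_kuen_frame delta1 delta2 Phi ->
     forall (k n : int) (t : R),
       net Phi k n t = quat_of_vec (f_kuen delta1 delta2 k n t) /\
       gauss_map Phi k n t = quat_of_vec (n_kuen delta1 delta2 k n t)).
Proof.
have [sin2_neq0 cos2_neq0] : sin delta2 != 0 /\ cos delta2 != 0.
  by apply/andP; rewrite -negb_or -mulf_eq0.
split; last first.
  by move=> Phi Phi_frame k n t; split; [exact: kuen_net|exact: kuen_gauss_map].
eexists; apply/(kuen_frameP sin1_neq0 sin1_neq1 sin1_neqN1 sin2_neq0 cos2_neq0).
by move=> k n t; reflexivity.
Qed.
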